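(* Let $B$ be a unital algebra, let $(\mathcal{A}, E, \varepsilon)$ be a $B$-$B$-noncommutative probability space, let $N\in\mathbb{N}$ and let $(x_j^{\ell}, x_j^{r})_{1\leqslant j\leqslant N}$ be a family of $B$-pairs in $\mathcal{A}$ which are bi-free and identically distributed with amalgamation over $B$. Let $\varphi$ be a state on $\mathcal{A}$ such that, for all $x\in\mathcal{A}$, $$\varphi\circ\varepsilon(E(x)\otimes 1)=\varphi(x)=\varphi\circ\varepsilon(1\otimes E(x)).$$ Then $(x_j^{\ell}, x_j^{r})_{1\leqslant j\leqslant N}$ is a quantum bi-exchangeable sequence of pairs in $(\mathcal{A},\varphi)$, i.e. for all $n\in\mathbb{N}$, all $\chi\in\{\ell,r\}^n$ and all $J=(j_1,\dots,j_n)\in\{1,\dots,N\}^n$, $$\varphi(x_{j_1}^{\chi(1)}\cdots x_{j_n}^{\chi(n)})\,1_{C(S_N^+)}=\sum_{I=(i_1,\dots,i_n)\in\{1,\dots,N\}^n}\varphi(x_{i_1}^{\chi(1)}\cdots x_{i_n}^{\chi(n)})\,u_{IJ}^\chi .$$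
   Context: **$B$-$B$-noncommutative probability space.** This is a triple $(\mathcal{A}, E, \varepsilon)$ where $\mathcal{A}$ and $B$ are unital (complex) algebras, $\varepsilon : B\otimes B^{op}\to\mathcal{A}$ is a unital homomorphism whose restrictions to $B\otimes 1$ and $1\otimes B^{op}$ are injective ($B^{op}$ is $B$ with reversed product), and $E:\mathcal{A}\to B$ is a linear map with $E(\varepsilon(b_1\otimes b_2)T)=b_1E(T)b_2$ and $E(T\varepsilon(b\otimes 1))=E(T\varepsilon(1\otimes b))$ for all $b,b_1,b_2\in B$, $T\in\mathcal{A}$. Write $L_b=\varepsilon(b\otimes 1)$ and $R_b=\varepsilon(1\otimes b)$. Set $\mathcal{A}_\ell=\{T\in\mathcal{A}: TR_b=R_bT\ \forall b\in B\}$ and $\mathcal{A}_r=\{T\in\mathcal{A}: TL_b=L_bT\ \forall b\in B\}$. **$B$-pairs and faces.** A $B$-pair is a pair $(x^\ell,x^r)$ with $x^\ell\in\mathcal{A}_\ell$, $x^r\in\mathcal{A}_r$. A pair of $B$-faces is a pair of subalgebras $(C^\ell,C^r)$ with $\varepsilon(B\otimes 1)\subset C^\ell\subset\mathcal{A}_\ell$ and $\varepsilon(1\otimes B^{op})\subset C^r\subset\mathcal{A}_r$. A family of $B$-pairs $(x_j^\ell,x_j^r)_j$ generates the pairs of $B$-faces $(C_j^\ell,C_j^r)_j$, where $C_j^\ell$ is the subalgebra generated by $x_j^\ell$ and $\varepsilon(B\otimes 1)$, and $C_j^r$ the subalgebra generated by $x_j^r$ and $\varepsilon(1\otimes B^{op})$.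 **Bi-freeness.** A $B$-$B$-bimodule with specified $B$-vector state is a triple $(X,\mathring{X},P)$ with $X=B\oplus\mathring{X}$ a direct sum of $B$-$B$-bimodules and $P:X\to B$, $b\oplus x\mapsto b$. Let $\mathcal{L}(X)$ be the algebra of all linear maps on $X$, let $L_b,R_b\in\mathcal{L}(X)$ be the left and right actions of $b\in B$, $\varepsilon(b_1\otimes b_2)=L_{b_1}R_{b_2}$, and $E_B(T)=P(T(1_B\oplus 0))$; then $(\mathcal{L}(X),E_B,\varepsilon)$ is a $B$-$B$-noncommutative probability space, with left and right algebras $\mathcal{L}_\ell(X)$, $\mathcal{L}_r(X)$. The free product of $(X_j,\mathring{X}_j,P_j)_j$ is $X=\ast_jX_j=B\oplus\mathring{X}$ with $\mathring{X}=\bigoplus_{k\geqslant1}\bigoplus_{i_1\neq i_2\neq\dots\neq i_k}\mathring{X}_{i_1}\otimes_B\dots\otimes_B\mathring{X}_{i_k}$ (consecutive indices distinct). Let $\mathring{X}(j)$ (resp. $\mathring{X}'(j)$) be the direct sum of those tensor products with $i_1\neq j$ (resp. $i_k\neq j$). There are natural isomorphisms $V_j:X_j\otimes_B(B\oplus\mathring{X}(j))\to X$ and $W_j:(B\oplus\mathring{X}'(j))\otimes_BX_j\to X$, and one sets $\lambda_j(T)=V_j(T\otimes\mathrm{id})V_j^{-1}$ for $T\in\mathcal{L}_\ell(X_j)$ and $\rho_j(T)=W_j(\mathrm{id}\otimes T)W_j^{-1}$ for $T\in\mathcal{L}_r(X_j)$. A family of pairs of $B$-faces $(C_j^\ell,C_j^r)_j$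 is bi-free with amalgamation over $B$ if there exist $B$-$B$-bimodules with specified $B$-vector states $(X_j,\mathring{X}_j,P_j)$ and $B$-morphisms (unital homomorphisms sending $L_b$ to $L_b$, resp. $R_b$ to $R_b$) $\ell_j:C_j^\ell\to\mathcal{L}_\ell(X_j)$, $r_j:C_j^r\to\mathcal{L}_r(X_j)$ such that the joint distribution of $(C_j^\ell,C_j^r)_j$ with respect to $E$ equals the joint distribution of $(\lambda_j\circ\ell_j(C_j^\ell),\rho_j\circ r_j(C_j^r))_j$ with respect to $E_B$ on $\mathcal{L}(\ast_jX_j)$ (i.e. $E$ of any product of elements of these faces equals $E_B$ of the corresponding product of images). A family of $B$-pairs is bi-free with amalgamation over $B$ if the faces it generates are. It is identically distributed with amalgamation over $B$ if all the pairs $(x_j^\ell,x_j^r)$ have the same $B$-valued joint distribution, i.e. the values $E(T_{b_1}x_j^{\chi(1)}T_{b_2}\cdots x_j^{\chi(n)}T_{b_{n+1}})$ (each $T$ being $L$ or $R$, $b_i\in B$) do not depend on $j$. **Quantum permutation group.** $C(S_N^+)$ is the universal unital C*-algebra generated by self-adjoint projections $u_{ij}$, $1\leqslant i,j\leqslant N$, with $\sum_iu_{ik}=1=\sum_ju_{kj}$ for all $k$. **Permutations $s_\chi$.** For $\chi\in\{\ell,r\}^n$, write $\chi^{-1}(\ell)=\{i_1<\dots<i_k\}$, $\chi^{-1}(r)=\{i_{k+1}>\dots>i_n\}$, and let $s_\chi\in S_n$ be $s_\chi(t)=i_t$. For $I=(i_1,\dots,i_n)$, $J=(j_1,\dots,j_n)$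 in $\{1,\dots,N\}^n$ set $u_{IJ}^\chi=u_{i_{s_\chi(1)}j_{s_\chi(1)}}\cdots u_{i_{s_\chi(n)}j_{s_\chi(n)}}$. *)

(* Defs.v *)
From HB Require Import structures.
From mathcomp Require Import all_boot all_order all_algebra perm.
From mathcomp Require Import complex freeg.
From mathcomp Require Import mathcomp_extra boolp classical_sets reals.

Set Implicit Arguments.
Unset Strict Implicit.
Unset Printing Implicit Defensive.

Import Order.TTheory GRing.Theory Num.Theory.
Local Open Scope classical_set_scope.
Local Open Scope ring_scope.
Local Open Scope quotient_scope.

Section FreeLift.
Variables (K : fieldType) (G : choiceType) (W : lmodType K) (f : G -> W).

Lemma fgliftN x : fglift f (- x) = - fglift f x.
Proof.
have h := @lift_is_additive K G W f.
by have := h 0 x; rewrite !sub0r => ->; have := h 0 0; rewrite !subrr => ->; rewrite sub0r.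
Qed.

Lemma fgliftD x y : fglift f (x + y) = fglift f x + fglift f y.
Proof.
have h := @lift_is_additive K G W f.
by have := h x (- y); rewrite opprK fgliftN opprK.
Qed.

Lemma fgliftZ k x : fglift f (k *: x) = k *: fglift f x.
Proof.
have f0 : fglift f 0 = 0 by apply: (addIr (fglift f 0)); rewrite -fgliftD !add0r.
rewrite -(freeg_sumE x); elim: (dom x) => [|g s IH].
  by rewrite big_nil scaler0 f0 scaler0.
rewrite big_cons scalerDr !fgliftD scalerDr IH; congr (_ + _).
have -> : k *: << coeff g x *g g >> = << k * coeff g x *g g >>.
  by apply/eqP/freeg_eqP => h; rewrite coeffZ !coeffU mulrA.
by rewrite !liftU scalerA.
Qed.

Lemma fgliftU1 g : fglift f << g >> = f g.
Proof. by rewrite liftU scale1r. Qed.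

Definition fgliftE := (fgliftD, fgliftN, fgliftZ, fgliftU1).

End FreeLift.

(* [pres S] is the free K-vector space on G modulo the span of the relators S;
   it is how all tensor products below are built. *)
Section Presentation.
Variables (K : fieldType) (G : choiceType) (S : set {freeg G / K}).
Local Notation F := {freeg G / K}.

Definition is_subspace (U : set F) : Prop :=
  U 0 /\ forall (k : K) x y, U x -> U y -> U (k *: x + y).

Definition relspan : set F := smallest is_subspace S.

Lemma span_subspace : is_subspace relspan.
Proof.
split; first by move=> U [[U0 _] _].
move=> k x y sx sy U hU; have [[_ UD] _] := hU.
exact: UD (sx U hU) (sy U hU).
Qed.

Lemma span_gen x : S x -> relspan x.
Proof. by move=> Sx U [_ SU]; apply: SU. Qed.

Lemma spanZ k x : relspan x -> relspan (k *: x).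
Proof.
by have [s0 sD] := span_subspace; move=> sx; rewrite -[_ *: _]addr0; apply: sD.
Qed.

Lemma spanD x y : relspan x -> relspan y -> relspan (x + y).
Proof.
by have [_ sD] := span_subspace => sx sy; have := sD 1 x y sx sy; rewrite scale1r.
Qed.

Definition eqmod : rel F := fun x y => `[< relspan (x - y) >].

Lemma eqmod_equiv : equiv_class_of eqmod.
Proof.
split=> [x | x y | y x z].
- by apply/asboolP; rewrite subrr; apply: span_subspace.1.
- by apply/asboolP/asboolP => /(@spanZ (-1)); rewrite scaleN1r opprB.
- move=> /asboolP xy /asboolP yz; apply/asboolP.
  by rewrite -(subrKA y) ; apply: spanD.
Qed.

Canonical eqmod_equivRel := EquivRelPack eqmod_equiv.

Definition pres := {eq_quot eqmod}.

HB.instance Definition _ : EqQuotient F eqmod pres := EqQuotient.on pres.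
HB.instance Definition _ := Choice.on pres.

Lemma pres_eqP (x y : F) : (\pi_pres x = \pi_pres y) <-> relspan (x - y).
Proof.
split=> [/eqmodP /asboolP //|h]; apply/eqmodP; exact/asboolP.
Qed.

Definition pres0 : pres := lift_cst pres 0.
Definition pres_opp := lift_op1 pres -%R.
Definition pres_add := lift_op2 pres +%R.
Definition pres_scale (k : K) := lift_op1 pres ( *:%R k).

Lemma pi_pres_opp : {morph \pi_pres : x / - x >-> pres_opp x}.
Proof.
move=> x; unlock pres_opp; apply/pres_eqP.
by rewrite -opprB opprK addrC -scaleN1r -[X in _ *: X]opprB; 
   apply: spanZ; rewrite -scaleN1r; apply: spanZ; apply/pres_eqP; rewrite reprK.
Qed.

Lemma pi_pres_add : {morph \pi_pres : x y / x + y >-> pres_add x y}.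
Proof.
move=> x y; unlock pres_add; apply/pres_eqP.
by rewrite opprD addrACA; apply: spanD; apply/pres_eqP; rewrite reprK.
Qed.

Lemma pi_pres_scale k : {morph \pi_pres : x / k *: x >-> pres_scale k x}.
Proof.
move=> x; unlock pres_scale; apply/pres_eqP.
by rewrite -scalerBr; apply: spanZ; apply/pres_eqP; rewrite reprK.
Qed.

Lemma pres_addA : associative pres_add.
Proof.
by elim/quotW=> x; elim/quotW=> y; elim/quotW=> z; rewrite -!pi_pres_add addrA.
Qed.
Lemma pres_addC : commutative pres_add.
Proof. by elim/quotW=> x; elim/quotW=> y; rewrite -!pi_pres_add addrC. Qed.
Lemma pres_add0 : left_id pres0 pres_add.
Proof.
by elim/quotW=> x; unlock pres0; rewrite -!pi_pres_add add0r.
Qed.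
Lemma pres_addN : left_inverse pres0 pres_opp pres_add.
Proof.
by elim/quotW=> x; unlock pres0; rewrite -pi_pres_opp -pi_pres_add addNr.
Qed.

HB.instance Definition _ :=
  GRing.isZmodule.Build pres pres_addA pres_addC pres_add0 pres_addN.

Lemma pres_scaleA a b x : pres_scale a (pres_scale b x) = pres_scale (a * b) x.
Proof. by elim/quotW: x => x; rewrite -!pi_pres_scale scalerA. Qed.
Lemma pres_scale1 : left_id 1 pres_scale.
Proof. by elim/quotW=> x; rewrite -!pi_pres_scale scale1r. Qed.
Lemma pres_scaleDr : right_distributive pres_scale +%R.
Proof.
move=> k; elim/quotW=> x; elim/quotW=> y.
by rewrite -[_ + _]pi_pres_add -!pi_pres_scale -[RHS]pi_pres_add scalerDr.
Qed.
Lemma pres_scaleDl x : {morph pres_scale^~ x : a b / a + b}.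
Proof.
elim/quotW: x => x a b.
by rewrite -!pi_pres_scale -[RHS]pi_pres_add scalerDl.
Qed.

HB.instance Definition _ := GRing.Zmodule_isLmodule.Build K pres
  pres_scaleA pres_scale1 pres_scaleDr pres_scaleDl.

Lemma piD (x y : F) : \pi_pres (x + y) = \pi_pres x + \pi_pres y.
Proof. exact: pi_pres_add. Qed.
Lemma piZ k (x : F) : \pi_pres (k *: x) = k *: \pi_pres x.
Proof. exact: pi_pres_scale. Qed.

Definition pres_gen (g : G) : pres := \pi_pres << g >>.

(* Only meaningful when the linear extension of f kills the relators, see
   [pres_lift_gen] and [pres_lift_lin]. *)
Definition pres_lift (W : lmodType K) (f : G -> W) (q : pres) : W :=
  fglift f (repr q).

Lemma pres_ind (P : pres -> Prop) :
  P 0 -> (forall k x y, P x -> P y -> P (k *: x + y)) ->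
  (forall g, P (pres_gen g)) -> forall q, P q.
Proof.
move=> P0 PD Pg; elim/quotW=> x; rewrite -(freeg_sumE x).
elim: (dom x) => [|g s IH].
  rewrite big_nil (_ : \pi_pres 0 = 0) //.
  by apply: (addIr (\pi_pres 0)); rewrite -piD !add0r.
rewrite big_cons piD (_ : << _ *g _ >> = coeff g x *: << g >>) ?piZ; last first.
  by apply/eqP/freeg_eqP => h; rewrite coeffZ !coeffU mul1r.
by apply: PD => //; apply: Pg.
Qed.

Section Lift.
Variables (W : lmodType K) (f : G -> W).
Hypothesis fS : forall r, S r -> fglift f r = 0.

Lemma pres_lift_pi x : pres_lift f (\pi x) = fglift f x.
Proof.
have span0 z : relspan z -> fglift f z = 0.
  move=> /(_ [set u | fglift f u = 0]); apply; split; last exact: fS.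
  split=> [|k u v fu fv]; last by rewrite /= !fgliftE fu fv scaler0 addr0.
  by have := fgliftZ f 0 0; rewrite !scale0r.
apply/eqP; rewrite -subr_eq0 -fgliftN -fgliftD; apply/eqP; apply: span0.
by apply/pres_eqP; rewrite reprK.
Qed.

Lemma pres_lift_gen g : pres_lift f (pres_gen g) = f g.
Proof. by rewrite pres_lift_pi fgliftU1. Qed.

Lemma pres_lift_lin k x y :
  pres_lift f (k *: x + y) = k *: pres_lift f x + pres_lift f y.
Proof.
elim/quotW: x => x; elim/quotW: y => y.
by rewrite -piZ -piD !pres_lift_pi !fgliftE.
Qed.

End Lift.

Lemma pres_rel r : S r -> \pi_pres r = 0.
Proof.
move=> Sr; have <- : \pi_pres 0 = 0.
  by apply: (addIr (\pi_pres 0)); rewrite -piD !add0r.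
by apply/pres_eqP; rewrite subr0; apply: span_gen.
Qed.

Lemma piN (x : F) : \pi_pres (- x) = - \pi_pres x.
Proof. by rewrite -scaleN1r piZ scaleN1r. Qed.

Definition presE := (piD, piN, piZ).

End Presentation.

Lemma pair_ext (T U : Type) (u v : T * U) : u.1 = v.1 -> u.2 = v.2 -> u = v.
Proof. by case: u v => [? ?] [? ?] /= -> ->. Qed.

Record bimodule (K : fieldType) (B : algType K) := Bimodule {
  bmod_sort :> lmodType K;
  lact : B -> bmod_sort -> bmod_sort;
  ract : bmod_sort -> B -> bmod_sort;
  lactPl : forall k a b x, lact (k *: a + b) x = k *: lact a x + lact b x;
  lactPr : forall k a x y, lact a (k *: x + y) = k *: lact a x + lact a y;
  lact1 : forall x, lact 1 x = x;
  lactM : forall a b x, lact (a * b) x = lact a (lact b x);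
  ractPl : forall k a x y, ract (k *: x + y) a = k *: ract x a + ract y a;
  ractPr : forall k a b x, ract x (k *: a + b) = k *: ract x a + ract x b;
  ract1 : forall x, ract x 1 = x;
  ractM : forall a b x, ract x (a * b) = ract (ract x a) b;
  lract : forall a b x, lact a (ract x b) = ract (lact a x) b
}.
Arguments Bimodule {K B}.

Section Bimodules.
Variables (K : fieldType) (B : algType K).

Section DirectSum.
Variable M : bimodule B.

Let lactX (b : B) (v : B * M) : B * M := (b * v.1, lact b v.2).
Let ractX (v : B * M) (b : B) : B * M := (v.1 * b, ract v.2 b).

(* B (+) M with the componentwise actions.  A B-B-bimodule with specified
   B-vector state (X, X°, P) is X = addB X°, with P the first projection. *)
Program Definition addB : bimodule B := Bimodule (B * M)%type lactX ractX
  _ _ _ _ _ _ _ _ _.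
Next Obligation. by move=> *; apply: pair_ext; rewrite /= ?mulrDl ?scalerAl ?lactPl. Qed.
Next Obligation. by move=> *; apply: pair_ext; rewrite /= ?mulrDr ?scalerAr ?lactPr. Qed.
Next Obligation. by move=> *; apply: pair_ext; rewrite /= ?mul1r ?lact1. Qed.
Next Obligation. by move=> *; apply: pair_ext; rewrite /= ?mulrA ?lactM. Qed.
Next Obligation. by move=> *; apply: pair_ext; rewrite /= ?mulrDl ?scalerAl ?ractPl. Qed.
Next Obligation. by move=> *; apply: pair_ext; rewrite /= ?mulrDr ?scalerAr ?ractPr. Qed.
Next Obligation. by move=> *; apply: pair_ext; rewrite /= ?mulr1 ?ract1. Qed.
Next Obligation. by move=> *; apply: pair_ext; rewrite /= ?mulrA ?ractM. Qed.
Next Obligation. by move=> *; apply: pair_ext; rewrite /= ?mulrA ?lract. Qed.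

End DirectSum.

Section Tensor.
Variables M N : bimodule B.

Inductive tensor_rel : set {freeg (M * N)%type / K} :=
| tensor_linl k x x' y : tensor_rel
    (<< (k *: x + x', y) >> - k *: << (x, y) >> - << (x', y) >>)
| tensor_linr k x y y' : tensor_rel
    (<< (x, k *: y + y') >> - k *: << (x, y) >> - << (x, y') >>)
| tensor_bal x b y : tensor_rel (<< (ract x b, y) >> - << (x, lact b y) >>).

(* The underlying vector space of M (x)_B N. *)
Definition tensor : lmodType K := pres tensor_rel.
Definition tens (x : M) (y : N) : tensor := pres_gen tensor_rel (x, y).

Lemma tensPl k x x' y : tens (k *: x + x') y = k *: tens x y + tens x' y.
Proof.
have := pres_rel (tensor_linl k x x' y); rewrite !presE -/(pres_gen _ _).
by rewrite -addrA -opprD => /subr0_eq.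
Qed.

Lemma tensPr k x y y' : tens x (k *: y + y') = k *: tens x y + tens x y'.
Proof.
have := pres_rel (tensor_linr k x y y'); rewrite !presE -/(pres_gen _ _).
by rewrite -addrA -opprD => /subr0_eq.
Qed.

Lemma tens_bal x b y : tens (ract x b) y = tens x (lact b y).
Proof.
have := pres_rel (tensor_bal x b y); rewrite !presE -/(pres_gen _ _).
by move=> /subr0_eq.
Qed.

Definition tensor_lift (W : lmodType K) (f : M -> N -> W) : tensor -> W :=
  pres_lift (fun xy => f xy.1 xy.2).

Section Lift.
Variables (W : lmodType K) (f : M -> N -> W).
Hypothesis fPl : forall k x x' y, f (k *: x + x') y = k *: f x y + f x' y.
Hypothesis fPr : forall k x y y', f x (k *: y + y') = k *: f x y + f x y'.
Hypothesis f_bal : forall x b y, f (ract x b) y = f x (lact b y).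

Lemma tensor_lift_rel r :
  tensor_rel r -> fglift (fun xy => f xy.1 xy.2) r = 0.
Proof.
by case=> *; rewrite !fgliftE /= ?fPl ?fPr ?f_bal ?subrr // -addrA -opprD subrr.
Qed.

Lemma tensor_lift_tens x y : tensor_lift f (tens x y) = f x y.
Proof. exact: (pres_lift_gen tensor_lift_rel). Qed.

Lemma tensor_liftP k t t' :
  tensor_lift f (k *: t + t') = k *: tensor_lift f t + tensor_lift f t'.
Proof. exact: (pres_lift_lin tensor_lift_rel). Qed.
End Lift.

Lemma tensor_ind (P : tensor -> Prop) :
  P 0 -> (forall k t t', P t -> P t' -> P (k *: t + t')) ->
  (forall x y, P (tens x y)) -> forall t, P t.
Proof. by move=> P0 PD Pt; apply: pres_ind => // -[x y]; apply: Pt. Qed.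

End Tensor.

Definition tens_map (M M' N N' : bimodule B) (S : M -> M') (T : N -> N') :
  tensor M N -> tensor M' N' := tensor_lift (fun x y => tens (S x) (T y)).

Lemma tens_map_tens (M M' N N' : bimodule B) (S : M -> M') (T : N -> N') x y :
  (forall k x x', S (k *: x + x') = k *: S x + S x') ->
  (forall k y y', T (k *: y + y') = k *: T y + T y') ->
  (forall x b, S (ract x b) = ract (S x) b) ->
  (forall b y, T (lact b y) = lact b (T y)) ->
  tens_map S T (tens x y) = tens (S x) (T y).
Proof.
move=> SP TP Sb Tb; rewrite /tens_map tensor_lift_tens //.
- by move=> *; rewrite SP tensPl.
- by move=> *; rewrite TP tensPr.
- by move=> *; rewrite Sb Tb tens_bal.
Qed.

Section Words.
Variables (I : choiceType) (X : I -> bimodule B).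
Local Notation letter := {i : I & X i}.

Definition ltr i (x : X i) : letter := existT (fun i => X i : Type) i x.

(* A word x_1 ... x_k with x_m in X_(i_m) stands for the elementary tensor
   x_1 (x) ... (x) x_k; its index sequence (i_1, ..., i_k) is nonempty, has
   distinct consecutive entries and is further restricted by p. *)
Definition admissible (p : pred (seq I)) (s : seq I) : bool :=
  [&& s != [::], sorted (fun i j => i != j) s & p s].

Section Free.
Variable p : pred (seq I).

Definition aword := {w : seq letter | admissible p (map tag w)}.

Inductive word_rel : set {freeg aword / K} :=
| word_lin u i k (x y : X i) v (w w1 w2 : aword) of
    val w = u ++ ltr (k *: x + y) :: v &
    val w1 = u ++ ltr x :: v & val w2 = u ++ ltr y :: v :
    word_rel (<< w >> - k *: << w1 >> - << w2 >>)
| word_bal u i (x : X i) b j (y : X j) v (w1 w2 : aword) of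
    val w1 = u ++ ltr (ract x b) :: ltr y :: v &
    val w2 = u ++ ltr x :: ltr (lact b y) :: v :
    word_rel (<< w1 >> - << w2 >>).

(* The relations never mix words with different index sequences, so this is the
   direct sum, over the admissible sequences (i_1, ..., i_k), of the spaces
   X_(i_1) (x)_B ... (x)_B X_(i_k). *)
Definition words : lmodType K := pres word_rel.

(* Zero on words that are not admissible. *)
Definition word (w : seq letter) : words :=
  oapp (pres_gen word_rel) 0 (insub w).

Lemma word0 w : ~~ admissible p (map tag w) -> word w = 0.
Proof. by move=> h; rewrite /word insubN. Qed.

Lemma word_gen (w : aword) : word (val w) = pres_gen word_rel w.
Proof. by rewrite /word valK. Qed.

Lemma wordP u i k (x y : X i) v :
  word (u ++ ltr (k *: x + y) :: v) =
  k *: word (u ++ ltr x :: v) + word (u ++ ltr y :: v).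
Proof.
set w := u ++ ltr (k *: x + y) :: v.
set w1 := u ++ ltr x :: v; set w2 := u ++ ltr y :: v.
have e1 : map tag w1 = map tag w by rewrite !map_cat.
have e2 : map tag w2 = map tag w by rewrite !map_cat.
have [h|h] := boolP (admissible p (map tag w)); last first.
  by rewrite !word0 ?e1 ?e2 // scaler0 addr0.
have h1 : admissible p (map tag w1) by rewrite e1.
have h2 : admissible p (map tag w2) by rewrite e2.
rewrite -[w]/(val (exist _ w h : aword)) -[w1]/(val (exist _ w1 h1 : aword)).
rewrite -[w2]/(val (exist _ w2 h2 : aword)) !word_gen.
have := pres_rel (@word_lin u i k x y v (exist _ w h) (exist _ w1 h1)
   (exist _ w2 h2) erefl erefl erefl).
by rewrite !presE -addrA -opprD => /subr0_eq.
Qed.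

Lemma word_balE u i (x : X i) b j (y : X j) v :
  word (u ++ ltr (ract x b) :: ltr y :: v) =
  word (u ++ ltr x :: ltr (lact b y) :: v).
Proof.
set w1 := u ++ ltr (ract x b) :: _; set w2 := u ++ ltr x :: _.
have e : map tag w2 = map tag w1 by rewrite !map_cat.
have [h1|h1] := boolP (admissible p (map tag w1)); last first.
  by rewrite !word0 ?e.
have h2 : admissible p (map tag w2) by rewrite e.
rewrite -[w1]/(val (exist _ w1 h1 : aword)).
rewrite -[w2]/(val (exist _ w2 h2 : aword)) !word_gen.
have := pres_rel (@word_bal u i x b j y v (exist _ w1 h1)
   (exist _ w2 h2) erefl erefl).
by rewrite !presE => /subr0_eq.
Qed.

Lemma words_ind (P : words -> Prop) :
  P 0 -> (forall k t t', P t -> P t' -> P (k *: t + t')) ->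
  (forall w, admissible p (map tag w) -> P (word w)) -> forall t, P t.
Proof.
move=> P0 PD Pt; apply: pres_ind => // w.
by rewrite -word_gen; apply: Pt; exact: (valP w).
Qed.

Definition words_lift (W : lmodType K) (f : seq letter -> W) : words -> W :=
  pres_lift (fun w : aword => f (val w)).

Definition multilinear (W : lmodType K) (f : seq letter -> W) :=
  forall u i k (x y : X i) v, admissible p (map tag (u ++ ltr x :: v)) ->
  f (u ++ ltr (k *: x + y) :: v) =
  k *: f (u ++ ltr x :: v) + f (u ++ ltr y :: v).

Definition balanced (W : lmodType K) (f : seq letter -> W) :=
  forall u i (x : X i) b j (y : X j) v,
  admissible p (map tag (u ++ ltr x :: ltr y :: v)) ->
  f (u ++ ltr (ract x b) :: ltr y :: v) =
  f (u ++ ltr x :: ltr (lact b y) :: v).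

Section Lift.
Variables (W : lmodType K) (f : seq letter -> W).
Hypotheses (fP : multilinear f) (f_bal : balanced f).

Lemma words_lift_rel r :
  word_rel r -> fglift (fun w : aword => f (val w)) r = 0.
Proof.
case=> [u i k x y v w w1 w2 e e1 e2|u i x b j y v w1 w2 e1 e2];
  rewrite !fgliftE.
  have h : admissible p (map tag (u ++ ltr x :: v)).
    by rewrite -e1; exact: (valP w1).
  by rewrite e e1 e2 fP // -addrA -opprD subrr.
rewrite e1 e2 f_bal ?subrr //.
by have := valP w1; rewrite e1 !map_cat.
Qed.

Lemma words_lift_word w :
  admissible p (map tag w) -> words_lift f (word w) = f w.
Proof.
move=> h; rewrite -[w]/(val (exist _ w h : aword)) word_gen.
exact: (pres_lift_gen words_lift_rel).
Qed.

Lemma words_liftP k t t' :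
  words_lift f (k *: t + t') = k *: words_lift f t + words_lift f t'.
Proof. exact: (pres_lift_lin words_lift_rel). Qed.
End Lift.

End Free.

Definition lactw (b : B) (w : seq letter) : seq letter :=
  if w is l :: w' then ltr (lact b (tagged l)) :: w' else [::].

Fixpoint ractw (w : seq letter) (b : B) : seq letter :=
  match w with
  | [::] => [::]
  | [:: l] => [:: ltr (ract (tagged l) b)]
  | l :: w' => l :: ractw w' b
  end.

Lemma tag_lactw b w : map tag (lactw b w) = map tag w.
Proof. by case: w. Qed.

Lemma ractw_rcons w l b : ractw (rcons w l) b = rcons w (ltr (ract (tagged l) b)).
Proof. by elim: w => //= l0 w <-; case: w. Qed.

Lemma tag_ractw w b : map tag (ractw w b) = map tag w.
Proof. by case/lastP: w => // w l; rewrite ractw_rcons !map_rcons. Qed.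

Lemma lactw_multilinear p q b : multilinear p (fun w => word q (lactw b w)).
Proof.
move=> [|l u] i k x y v _ /=; last exact: (wordP q (_ :: u)).
by rewrite lactPr; exact: (wordP q [::]).
Qed.

Lemma lactw_balanced p q b : balanced p (fun w => word q (lactw b w)).
Proof.
move=> [|l u] i x c j y v _ /=; last exact: (word_balE q (_ :: u)).
by rewrite lract; exact: (word_balE q [::]).
Qed.

Lemma ractw_multilinear p q b : multilinear p (fun w => word q (ractw w b)).
Proof.
move=> u i k x y v _; case/lastP: v => [|v l].
  by rewrite !cats1 !ractw_rcons /= ractPl -!cats1 wordP.
by rewrite -!rcons_cons -!rcons_cat !ractw_rcons !rcons_cat !rcons_cons wordP.
Qed.

Lemma ractw_balanced p q b : balanced p (fun w => word q (ractw w b)).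
Proof.
move=> u i x c j y v _; case/lastP: v => [|v l].
  rewrite -![u ++ [:: _; _]]cat_rcons !cats1 !ractw_rcons /= -lract -!cats1.
  by rewrite -!catA /= word_balE.
by rewrite -!rcons_cons -!rcons_cat !ractw_rcons !rcons_cat !rcons_cons word_balE.
Qed.

Section WordsBimodule.
Variable p : pred (seq I).
Local Notation wd := (word p).

Definition words_lact b : words p -> words p :=
  words_lift (fun w => wd (lactw b w)).
Definition words_ract (t : words p) b : words p :=
  words_lift (fun w => wd (ractw w b)) t.

Lemma words_lact_word b w : words_lact b (wd w) = wd (lactw b w).
Proof.
have mb := (lactw_multilinear (p := p) p b, lactw_balanced (p := p) p b).
have [h|h] := boolP (admissible p (map tag w)).
  by rewrite /words_lact words_lift_word //; [exact: mb.1|exact: mb.2].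
rewrite !word0 ?tag_lactw // /words_lact.
by have := words_liftP mb.1 mb.2 (-1) 0 0; rewrite scaler0 addr0 scaleN1r addNr.
Qed.

Lemma words_ract_word w b : words_ract (wd w) b = wd (ractw w b).
Proof.
have mb := (ractw_multilinear (p := p) p b, ractw_balanced (p := p) p b).
have [h|h] := boolP (admissible p (map tag w)).
  by rewrite /words_ract words_lift_word //; [exact: mb.1|exact: mb.2].
rewrite !word0 ?tag_ractw // /words_ract.
by have := words_liftP mb.1 mb.2 (-1) 0 0; rewrite scaler0 addr0 scaleN1r addNr.
Qed.

Lemma words_lactPr k b t t' :
  words_lact b (k *: t + t') = k *: words_lact b t + words_lact b t'.
Proof. by rewrite /words_lact words_liftP //; [exact: lactw_multilinear|exact: lactw_balanced]. Qed.

Lemma words_ractPl k b t t' :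
  words_ract (k *: t + t') b = k *: words_ract t b + words_ract t' b.
Proof. by rewrite /words_ract words_liftP //; [exact: ractw_multilinear|exact: ractw_balanced]. Qed.

Lemma words_lact0 b : words_lact b 0 = 0.
Proof. by have := words_lactPr (-1) b 0 0; rewrite scaler0 addr0 scaleN1r addNr. Qed.
Lemma words_ract0 b : words_ract 0 b = 0.
Proof. by have := words_ractPl (-1) b 0 0; rewrite scaler0 addr0 scaleN1r addNr. Qed.

Lemma words_lactPl k a b t :
  words_lact (k *: a + b) t = k *: words_lact a t + words_lact b t.
Proof.
elim/words_ind: t => [|c t t' IH IH'|w _].
- by rewrite !words_lact0 scaler0 addr0.
- rewrite !words_lactPr IH IH' !scalerDr !scalerA [c * k]mulrC.
  by rewrite -!addrA; congr (_ + _); rewrite addrCA.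
- rewrite !words_lact_word; case: w => [|l w] /=.
    by rewrite word0 // scaler0 addr0.
  by rewrite lactPl (wordP p [::]).
Qed.

Lemma words_ractPr k a b t :
  words_ract t (k *: a + b) = k *: words_ract t a + words_ract t b.
Proof.
elim/words_ind: t => [|c t t' IH IH'|w _].
- by rewrite !words_ract0 scaler0 addr0.
- rewrite !words_ractPl IH IH' !scalerDr !scalerA [c * k]mulrC.
  by rewrite -!addrA; congr (_ + _); rewrite addrCA.
- rewrite !words_ract_word; case/lastP: w => [|w l] /=.
    by rewrite word0 // scaler0 addr0.
  by rewrite !ractw_rcons ractPr -!cats1 wordP.
Qed.

Lemma words_lact1 t : words_lact 1 t = t.
Proof.
elim/words_ind: t => [|c t t' IH IH'|[|[i x] w] _]; rewrite ?words_lact0 //.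
  by rewrite words_lactPr IH IH'.
  by rewrite words_lact_word.
by rewrite words_lact_word /= lact1.
Qed.

Lemma words_ract1 t : words_ract t 1 = t.
Proof.
elim/words_ind: t => [|c t t' IH IH'|w _]; rewrite ?words_ract0 //.
  by rewrite words_ractPl IH IH'.
rewrite words_ract_word; case/lastP: w => // w [i x].
by rewrite ractw_rcons ract1.
Qed.

Lemma words_lactM a b t : words_lact (a * b) t = words_lact a (words_lact b t).
Proof.
elim/words_ind: t => [|c t t' IH IH'|[|l w] _]; rewrite ?words_lact0 //.
- by rewrite !words_lactPr IH IH'.
- by rewrite !words_lact_word.
by rewrite !words_lact_word /= lactM.
Qed.

Lemma words_ractM a b t : words_ract t (a * b) = words_ract (words_ract t a) b.
Proof.
elim/words_ind: t => [|c t t' IH IH'|w _]; rewrite ?words_ract0 //.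
  by rewrite !words_ractPl IH IH'.
rewrite !words_ract_word; case/lastP: w => // w l.
by rewrite !ractw_rcons ractM.
Qed.

Lemma words_lract a b t :
  words_lact a (words_ract t b) = words_ract (words_lact a t) b.
Proof.
elim/words_ind: t => [|c t t' IH IH'|w _].
- by rewrite words_ract0 !words_lact0 words_ract0.
- by rewrite !words_ractPl !words_lactPr IH IH' words_ractPl.
rewrite words_ract_word !words_lact_word words_ract_word; congr (wd _).
by case: w => [|l [|l' w]] //=; rewrite lract.
Qed.

(* B acts on the left on the first letter and on the right on the last one. *)
Definition tprods : bimodule B := Bimodule (words p) words_lact words_ract
  words_lactPl words_lactPr words_lact1 words_lactM
  words_ractPl words_ractPr words_ract1 words_ractM words_lract.

End WordsBimodule.

Lemma lin0 (U W : lmodType K) (f : U -> W) :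
  (forall k x y, f (k *: x + y) = k *: f x + f y) -> f 0 = 0.
Proof. by move=> fP; have := fP (-1) 0 0; rewrite scaler0 addr0 scaleN1r addNr. Qed.

Lemma linD (U W : lmodType K) (f : U -> W) :
  (forall k x y, f (k *: x + y) = k *: f x + f y) -> forall x y, f (x + y) = f x + f y.
Proof. by move=> fP x y; have := fP 1 x y; rewrite !scale1r. Qed.

Lemma lact_word p b w : lact b (word p w : tprods p) = word p (lactw b w).
Proof. exact: words_lact_word. Qed.

Lemma ract_word p b w : ract (word p w : tprods p) b = word p (ractw w b).
Proof. exact: words_ract_word. Qed.

(* The X i are the summands X_i° of the X_i = B (+) X_i°.  The free product is
   B (+) X°, where X° uses all the admissible words, while X°(j) (resp. X°'(j))
   uses those whose first (resp. last) index is not j. *)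
Definition free_prod : bimodule B := addB (tprods xpredT).

Definition not_head (j : I) : pred (seq I) := fun s => head j s != j.
Definition not_last (j : I) : pred (seq I) := fun s => last j s != j.

Section Emb.
Variable p : pred (seq I).

Definition emb : words p -> words xpredT := words_lift (word xpredT).

Let mul : multilinear p (word xpredT). Proof. by move=> *; apply: wordP. Qed.
Let bal : balanced p (word xpredT). Proof. by move=> *; apply: word_balE. Qed.

Lemma emb_word w : admissible p (map tag w) -> emb (word p w) = word xpredT w.
Proof. by move=> h; rewrite /emb words_lift_word. Qed.

Lemma embP k t t' : emb (k *: t + t') = k *: emb t + emb t'.
Proof. exact: words_liftP. Qed.

Definition prepend i (x : X i) : words p -> words xpredT :=
  words_lift (fun w => word xpredT (ltr x :: w)).
Definition append (t : words p) i (x : X i) : words xpredT :=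
  words_lift (fun w => word xpredT (rcons w (ltr x))) t.

Let mul_pre i (x : X i) : multilinear p (fun w => word xpredT (ltr x :: w)).
Proof. by move=> u *; apply: (wordP xpredT (_ :: u)). Qed.
Let bal_pre i (x : X i) : balanced p (fun w => word xpredT (ltr x :: w)).
Proof. by move=> u *; apply: (word_balE xpredT (_ :: u)). Qed.
Let mul_app i (x : X i) : multilinear p (fun w => word xpredT (rcons w (ltr x))).
Proof. by move=> *; rewrite !rcons_cat !rcons_cons wordP. Qed.
Let bal_app i (x : X i) : balanced p (fun w => word xpredT (rcons w (ltr x))).
Proof. by move=> *; rewrite !rcons_cat !rcons_cons word_balE. Qed.

Lemma prepend_word i (x : X i) w : admissible p (map tag w) ->
  prepend x (word p w) = word xpredT (ltr x :: w).
Proof. by move=> h; rewrite /prepend words_lift_word. Qed.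

Lemma prependPr i (x : X i) k t t' :
  prepend x (k *: t + t') = k *: prepend x t + prepend x t'.
Proof. exact: words_liftP. Qed.

Lemma append_word i (x : X i) w : admissible p (map tag w) ->
  append (word p w) x = word xpredT (rcons w (ltr x)).
Proof. by move=> h; rewrite /append words_lift_word. Qed.

Lemma appendPl i (x : X i) k t t' :
  append (k *: t + t') x = k *: append t x + append t' x.
Proof. by rewrite /append words_liftP. Qed.

Lemma prependPl i k (x y : X i) t :
  prepend (k *: x + y) t = k *: prepend x t + prepend y t.
Proof.
elim/words_ind: t => [|c t t' IH IH'|w h].
- by rewrite !(lin0 (prependPr _)) scaler0 addr0.
- rewrite !prependPr IH IH' !scalerDr !scalerA [c * k]mulrC.
  by rewrite -!addrA; congr (_ + _); rewrite addrCA.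
- by rewrite !prepend_word // (wordP xpredT [::]).
Qed.

Lemma appendPr i k (x y : X i) t :
  append t (k *: x + y) = k *: append t x + append t y.
Proof.
have a0 (z : X i) : append 0 z = 0.
  exact: (@lin0 _ _ (fun t => append t z) (appendPl z)).
elim/words_ind: t => [|c t t' IH IH'|w h].
- by rewrite !a0 scaler0 addr0.
- rewrite !appendPl IH IH' !scalerDr !scalerA [c * k]mulrC.
  by rewrite -!addrA; congr (_ + _); rewrite addrCA.
- by rewrite !append_word // -!cats1 wordP.
Qed.

Lemma prepend_bal i (x : X i) b t :
  prepend (ract x b) t = prepend x (lact (b : B) (t : tprods p)).
Proof.
elim/words_ind: t => [|c t t' IH IH'|[|[j y] w] h] //.
- by rewrite (lin0 (fun k => lactPr k b)) !(lin0 (prependPr _)).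
- by rewrite lactPr !prependPr IH IH'.
- rewrite lact_word !prepend_word //=.
  exact: (word_balE xpredT [::]).
Qed.

Lemma append_bal i (x : X i) b t :
  append (ract (t : tprods p) b) x = append t (lact b x).
Proof.
have a0 (z : X i) : append 0 z = 0.
  exact: (@lin0 _ _ (fun t => append t z) (appendPl z)).
elim/words_ind: t => [|c t t' IH IH'|w h] //.
- by rewrite (@lin0 _ _ (fun t : tprods p => ract t b) (fun k => ractPl k b)) !a0.
- by rewrite ractPl !appendPl IH IH'.
- rewrite ract_word !append_word ?tag_ractw //.
  case/lastP: w h => // w [j y] h.
  by rewrite ractw_rcons /= -!cats1 -!catA word_balE.
Qed.

End Emb.

Section Action.
Variable j : I.

Local Notation tV := (@tens (addB (X j)) (addB (tprods (not_head j)))).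
Local Notation tW := (@tens (addB (tprods (not_last j))) (addB (X j))).

Definition tensV := tensor (addB (X j)) (addB (tprods (not_head j))).
Definition tensW := tensor (addB (tprods (not_last j))) (addB (X j)).

(* (b (+) x) (x) (b' (+) t) is sent to
   bb' (+) (x b' + b t + x (x) t), where x b' is a word of length one. *)
Definition Vfun (xi : addB (X j)) (eta : addB (tprods (not_head j))) : free_prod :=
  (xi.1 * eta.1,
   word xpredT [:: ltr (ract xi.2 eta.1)] + emb (lact xi.1 eta.2)
   + prepend xi.2 eta.2).

Definition Wfun (eta : addB (tprods (not_last j))) (xi : addB (X j)) : free_prod :=
  (eta.1 * xi.1,
   word xpredT [:: ltr (lact eta.1 xi.2)] + emb (ract eta.2 xi.1)
   + append eta.2 xi.2).

Definition Viso : tensV -> free_prod := tensor_lift Vfun.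
Definition Wiso : tensW -> free_prod := tensor_lift Wfun.

Definition Vinv_word (w : seq letter) : tensV :=
  if w is l :: w' then
    untag (tV (1, 0) (0, word (not_head j) w))
      (fun x : X j =>
         tV (0, x) (if w' is [::] then (1, 0) else (0, word (not_head j) w')))
      l
  else 0.

Definition Winv_word (w : seq letter) : tensW :=
  if rev w is l :: w' then
    untag (tW (0, word (not_last j) w) (1, 0))
      (fun x : X j =>
         tW (if w' is [::] then (1, 0) else (0, word (not_last j) (rev w')))
           (0, x))
      l
  else 0.

Definition Viso_inv (z : free_prod) : tensV :=
  tV (z.1, 0) (1, 0) + words_lift Vinv_word z.2.
Definition Wiso_inv (z : free_prod) : tensW :=
  tW (1, 0) (z.1, 0) + words_lift Winv_word z.2.

Lemma lin3 (U : lmodType K) k (a b c a' b' c' : U) :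
  (k *: a + a') + (k *: b + b') + (k *: c + c') =
  k *: (a + b + c) + (a' + b' + c').
Proof. by rewrite !scalerDr [X in X + _ = _]addrACA [LHS]addrACA. Qed.
Lemma addB1 (M : bimodule B) k (x y : addB M) : (k *: x + y).1 = k *: x.1 + y.1.
Proof. by []. Qed.
Lemma addB2 (M : bimodule B) k (x y : addB M) : (k *: x + y).2 = k *: x.2 + y.2.
Proof. by []. Qed.

Lemma Vfun1 x y : (Vfun x y).1 = x.1 * y.1. Proof. by []. Qed.
Lemma Vfun2 x y : (Vfun x y).2 =
  word xpredT [:: ltr (ract x.2 y.1)] + emb (lact x.1 y.2) + prepend x.2 y.2.
Proof. by []. Qed.
Lemma Wfun1 y x : (Wfun y x).1 = y.1 * x.1. Proof. by []. Qed.
Lemma Wfun2 y x : (Wfun y x).2 =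
  word xpredT [:: ltr (lact y.1 x.2)] + emb (ract y.2 x.1) + append y.2 x.2.
Proof. by []. Qed.
Lemma addB_lact (M : bimodule B) b (x : addB M) : lact b x = (b * x.1, lact b x.2).
Proof. by []. Qed.
Lemma addB_ract (M : bimodule B) b (x : addB M) : ract x b = (x.1 * b, ract x.2 b).
Proof. by []. Qed.

Lemma word1P i k (x y : X i) p :
  word p [:: ltr (k *: x + y)] = k *: word p [:: ltr x] + word p [:: ltr y].
Proof. exact: (wordP p [::] k x y [::]). Qed.

Lemma VfunPl k x x' y : Vfun (k *: x + x') y = k *: Vfun x y + Vfun x' y.
Proof.
apply: pair_ext; rewrite !(addB1, addB2, Vfun1, Vfun2); first by rewrite mulrDl scalerAl.
by rewrite ractPl word1P lactPl embP prependPl lin3.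
Qed.

Lemma VfunPr k x y y' : Vfun x (k *: y + y') = k *: Vfun x y + Vfun x y'.
Proof.
apply: pair_ext; rewrite !(addB1, addB2, Vfun1, Vfun2); first by rewrite mulrDr scalerAr.
by rewrite ractPr word1P lactPr embP prependPr lin3.
Qed.

Lemma WfunPl k x x' y : Wfun (k *: x + x') y = k *: Wfun x y + Wfun x' y.
Proof.
apply: pair_ext; rewrite !(addB1, addB2, Wfun1, Wfun2); first by rewrite mulrDl scalerAl.
by rewrite lactPl word1P ractPl embP appendPl lin3.
Qed.

Lemma WfunPr k x y y' : Wfun x (k *: y + y') = k *: Wfun x y + Wfun x y'.
Proof.
apply: pair_ext; rewrite !(addB1, addB2, Wfun1, Wfun2); first by rewrite mulrDr scalerAr.
by rewrite lactPr word1P ractPr embP appendPr lin3.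
Qed.

Lemma Vfun_bal x b y : Vfun (ract x b) y = Vfun x (lact b y).
Proof.
case: x y => [x1 x2] [y1 y2]; apply: pair_ext; rewrite !(Vfun1, Vfun2).
  exact/esym/mulrA.
rewrite -[LHS]/(word xpredT [:: ltr (ract (ract x2 b) y1)]
  + emb (lact (x1 * b) y2) + prepend (ract x2 b) y2).
by rewrite -ractM lactM prepend_bal.
Qed.

Lemma Wfun_bal x b y : Wfun (ract x b) y = Wfun x (lact b y).
Proof.
case: x y => [x1 x2] [y1 y2]; apply: pair_ext; rewrite !(Wfun1, Wfun2).
  exact/esym/mulrA.
rewrite -[LHS]/(word xpredT [:: ltr (lact (x1 * b) y2)]
  + emb (ract (ract x2 b) y1) + append (ract x2 b) y2).
by rewrite lactM -ractM append_bal.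
Qed.

Lemma Viso_tens x y : Viso (tens x y) = Vfun x y.
Proof. exact: tensor_lift_tens VfunPl VfunPr Vfun_bal x y. Qed.
Lemma VisoP k t t' : Viso (k *: t + t') = k *: Viso t + Viso t'.
Proof. exact: tensor_liftP VfunPl VfunPr Vfun_bal k t t'. Qed.
Lemma Wiso_tens x y : Wiso (tens x y) = Wfun x y.
Proof. exact: tensor_lift_tens WfunPl WfunPr Wfun_bal x y. Qed.
Lemma WisoP k t t' : Wiso (k *: t + t') = k *: Wiso t + Wiso t'.
Proof. exact: tensor_liftP WfunPl WfunPr Wfun_bal k t t'. Qed.

Lemma tensDl0 (M N : bimodule B) (y : N) : tens (0 : M) y = 0.
Proof. exact: (@lin0 _ _ (fun x : M => tens x y) (fun k x x' => tensPl k x x' y)). Qed.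

Lemma tensDr0 (M N : bimodule B) (x : M) : tens x (0 : N) = 0.
Proof. exact: (@lin0 _ _ (fun y : N => tens x y) (fun k y y' => tensPr k x y y')). Qed.

Lemma inr_lin (M : bimodule B) k (x y : M) :
  ((0, k *: x + y) : addB M) = k *: ((0, x) : addB M) + (0, y).
Proof. by apply: pair_ext; rewrite /= ?scaler0 ?addr0. Qed.

Lemma untag_ltr (R : Type) (d : R) (F : X j -> R) (x : X j) :
  untag d F (ltr x) = F x.
Proof. by rewrite (untagE d F (erefl : tag (ltr x) = j)). Qed.

Lemma untag_ltrN (R : Type) (d : R) (F : X j -> R) i (x : X i) :
  i != j -> untag d F (ltr x) = d.
Proof. by move=> h; apply: untag_dflt. Qed.

Lemma tens0P (M N : bimodule B) (x : M) k (y y' : N) :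
  tens x ((0, k *: y + y') : addB N) =
  k *: tens x ((0, y) : addB N) + tens x ((0, y') : addB N).
Proof. by rewrite inr_lin tensPr. Qed.

Lemma tens0Pl (M N : bimodule B) k (x x' : M) (y : N) :
  tens ((0, k *: x + x') : addB M) y =
  k *: tens ((0, x) : addB M) y + tens ((0, x') : addB M) y.
Proof. by rewrite inr_lin tensPl. Qed.

Lemma lact_inr (M : bimodule B) b (x : M) :
  lact b ((0, x) : addB M) = (0, lact b x).
Proof. by apply: pair_ext => //=; rewrite mulr0. Qed.

Lemma ract_inr (M : bimodule B) b (x : M) :
  ract ((0, x) : addB M) b = (0, ract x b).
Proof. by apply: pair_ext => //=; rewrite mul0r. Qed.

Lemma tV0P x k (t t' : words (not_head j)) :
  tV x (0, k *: t + t') = k *: tV x (0, t) + tV x (0, t').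
Proof. exact: (@tens0P _ (tprods (not_head j))). Qed.

Lemma tW0P x k (t t' : words (not_last j)) :
  tW (0, k *: t + t') x = k *: tW (0, t) x + tW (0, t') x.
Proof. exact: (@tens0Pl (tprods (not_last j))). Qed.

Lemma Vinv_wordP : multilinear xpredT Vinv_word.
Proof.
move=> [|l u] i k x y v h /=.
  have [e|ne] := eqVneq i j.
    by subst i; rewrite !untag_ltr tens0Pl.
  by rewrite !untag_ltrN // (wordP _ [::]) tV0P.
case: l h => i' z h; have [e|ne] := eqVneq i' j.
  subst i'; rewrite !untag_ltr.
  case: u h => [|l' u] h /=; rewrite ?(wordP _ [::]) ?(wordP _ (_ :: u)); exact: tV0P.
by rewrite !untag_ltrN // (wordP _ (_ :: u)) tV0P.
Qed.

Lemma Vinv_word_bal : balanced xpredT Vinv_word.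
Proof.
move=> [|l u] i x b i' y v h /=.
  have [e|ne] := eqVneq i j.
    by subst i; rewrite !untag_ltr -ract_inr tens_bal lact_inr lact_word.
  by rewrite !untag_ltrN // (word_balE _ [::]).
case: l h => i0 z h; have [e|ne] := eqVneq i0 j.
  subst i0; rewrite !untag_ltr.
  by case: u h => [|l' u] h /=; rewrite ?(word_balE _ [::]) ?(word_balE _ (_ :: u)).
by rewrite !untag_ltrN // (word_balE _ (_ :: u)).
Qed.

Lemma Winv_word_rcons w l : Winv_word (rcons w l) =
  untag (tW (0, word (not_last j) (rcons w l)) (1, 0))
    (fun x : X j =>
       tW (if w is [::] then (1, 0) else (0, word (not_last j) w)) (0, x)) l.
Proof.
rewrite /Winv_word rev_rcons; congr (untag _ _ _).
apply/funext => x; rewrite revK; case/lastP: w => // w l'.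
by rewrite rev_rcons; case: (w).
Qed.

Lemma tW0Pr y k (x x' : X j) :
  tW y (0, k *: x + x') = k *: tW y (0, x) + tW y (0, x').
Proof. exact: (@tens0P _ (X j)). Qed.

Lemma Winv_wordP : multilinear xpredT Winv_word.
Proof.
move=> u i k x y v h; case/lastP: v h => [|v l] h.
  rewrite !cats1 !Winv_word_rcons.
  have [e|ne] := eqVneq i j.
    by subst i; rewrite !untag_ltr tW0Pr.
  by rewrite !untag_ltrN // -!cats1 wordP tW0P.
rewrite -!rcons_cons -!rcons_cat !Winv_word_rcons.
case: l h => i' z h; have [e|ne] := eqVneq i' j; last first.
  by rewrite !untag_ltrN // !rcons_cat !rcons_cons wordP tW0P.
subst i'; rewrite !untag_ltr.
by case: u h => [|l u] h /=; rewrite ?(wordP _ [::]) ?(wordP _ (_ :: u)); exact: tW0P.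
Qed.

Lemma Winv_word_bal : balanced xpredT Winv_word.
Proof.
move=> u i x b i' y v h; case/lastP: v h => [|v l] h.
  rewrite -![u ++ [:: _; _]]cat_rcons !cats1 !Winv_word_rcons.
  have [e|ne] := eqVneq i' j.
    subst i'; rewrite !untag_ltr -lact_inr -tens_bal.
    have nil (l : letter) : (if rcons u l is [::] then (1, 0)
      else (0, word (not_last j) (rcons u l)) : addB (tprods (not_last j)))
      = (0, word (not_last j) (rcons u l)) by case: (u).
    by rewrite !nil ract_inr ract_word ractw_rcons.
  by rewrite !untag_ltrN // -!cats1 -!catA word_balE.
rewrite -!rcons_cons -!rcons_cat !Winv_word_rcons.
case: l h => i0 z h; have [e|ne] := eqVneq i0 j; last first.
  by rewrite !untag_ltrN // !rcons_cat !rcons_cons word_balE.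
subst i0; rewrite !untag_ltr.
by case: u h => [|l u] h /=; rewrite ?(word_balE _ [::]) ?(word_balE _ (_ :: u)).
Qed.

Let liftV := words_lift (p := xpredT) Vinv_word.
Let liftW := words_lift (p := xpredT) Winv_word.

Let liftVP k t t' : liftV (k *: t + t') = k *: liftV t + liftV t'.
Proof. exact: words_liftP Vinv_wordP Vinv_word_bal k t t'. Qed.
Let liftWP k t t' : liftW (k *: t + t') = k *: liftW t + liftW t'.
Proof. exact: words_liftP Winv_wordP Winv_word_bal k t t'. Qed.
Let liftV_word w : admissible xpredT (map tag w) ->
  liftV (word xpredT w) = Vinv_word w.
Proof. exact: words_lift_word Vinv_wordP Vinv_word_bal w. Qed.
Let liftW_word w : admissible xpredT (map tag w) ->
  liftW (word xpredT w) = Winv_word w.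
Proof. exact: words_lift_word Winv_wordP Winv_word_bal w. Qed.

Let lact0r (M : bimodule B) b : lact b (0 : M) = 0.
Proof. exact: (lin0 (fun k => @lactPr _ _ M k b)). Qed.
Let ract0l (M : bimodule B) b : ract (0 : M) b = 0.
Proof. exact: (@lin0 _ _ (fun x : M => ract x b) (fun k => ractPl k b)). Qed.
Let lact0l (M : bimodule B) (x : M) : lact 0 x = 0.
Proof. exact: (@lin0 _ _ (fun b : B => lact b x) (fun k a b => lactPl k a b x)). Qed.
Let ract0r (M : bimodule B) (x : M) : ract x 0 = 0.
Proof. exact: (@lin0 _ _ (fun b : B => ract x b) (fun k a b => ractPr k a b x)). Qed.
Let word0l i p : word p [:: ltr (0 : X i)] = 0.
Proof. exact: (lin0 (fun k x y => word1P k x y p)). Qed.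
Let emb0 p : emb (0 : words p) = 0.
Proof. exact: (lin0 (@embP p)). Qed.
Let prepend0r p i (x : X i) : prepend x (0 : words p) = 0.
Proof. exact: (lin0 (@prependPr p i x)). Qed.
Let prepend0l p i (t : words p) : prepend (0 : X i) t = 0.
Proof. exact: (@lin0 _ _ (fun x : X i => prepend x t) (fun k x y => prependPl k x y t)). Qed.
Let append0r p i (t : words p) : append t (0 : X i) = 0.
Proof. exact: (lin0 (fun k (x y : X i) => appendPr k x y t)). Qed.
Let append0l p i (x : X i) : append (0 : words p) x = 0.
Proof. exact: (@lin0 _ _ (fun t : words p => append t x) (appendPl x)). Qed.
Let simp0 := (lact0r, ract0l, lact0l, ract0r, word0l, emb0, prepend0r,
  prepend0l, append0r, append0l, addr0, add0r, mulr0, mul0r, mulr1, mul1r).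

Let VfunE a (x : X j) b (t : tprods (not_head j)) : Viso (tV (a, x) (b, t)) =
  (a * b, word xpredT [:: ltr (ract x b)] + emb (lact a t) + prepend x t).
Proof. exact: Viso_tens. Qed.
Let WfunE a (x : X j) b (t : tprods (not_last j)) : Wiso (tW (b, t) (a, x)) =
  (b * a, word xpredT [:: ltr (lact b x)] + emb (ract t a) + append t x).
Proof. exact: Wiso_tens. Qed.
Let V11 b : Viso (tV (b, 0) (1, 0)) = (b, 0).
Proof. by rewrite VfunE !simp0. Qed.
Let V21 x : Viso (tV (0, x) (1, 0)) = (0, word xpredT [:: ltr x]).
Proof. by rewrite VfunE ract1 !simp0. Qed.
Let V12 t : Viso (tV (1, 0) (0, t)) = (0, emb t).
Proof. by rewrite VfunE lact1 !simp0. Qed.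
Let V22 x t : Viso (tV (0, x) (0, t)) = (0, prepend x t).
Proof. by rewrite VfunE !simp0. Qed.

Let W11 b : Wiso (tW (1, 0) (b, 0)) = (b, 0).
Proof. by rewrite WfunE !simp0. Qed.
Let W12 x : Wiso (tW (1, 0) (0, x)) = (0, word xpredT [:: ltr x]).
Proof. by rewrite WfunE lact1 !simp0. Qed.
Let W21 t : Wiso (tW (0, t) (1, 0)) = (0, emb t).
Proof. by rewrite WfunE ract1 !simp0. Qed.
Let W22 x t : Wiso (tW (0, t) (0, x)) = (0, append t x).
Proof. by rewrite WfunE !simp0. Qed.

Lemma Viso_invK : cancel Viso_inv Viso.
Proof.
move=> [b t]; rewrite /Viso_inv /= (linD VisoP) V11.
suff -> : Viso (liftV t) = (0, t) by apply: pair_ext; rewrite /= ?simp0.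
elim/words_ind: t => [|k t t' IH IH'|w h].
- by rewrite (lin0 liftVP) (lin0 VisoP).
- by rewrite liftVP VisoP IH IH' inr_lin.
rewrite liftV_word //; case: w h => [//|[i x] w] h /=.
have [e|ne] := eqVneq i j; last first.
  rewrite untag_ltrN // V12 emb_word //; case/and3P: h => h1 h2 _.
  by rewrite /admissible h1 h2 /not_head /= ne.
subst i; rewrite untag_ltr; case: w h => [|[i y] w] h; first by rewrite V21.
rewrite V22 prepend_word //.
move: h; rewrite /admissible /not_head /= !andbT => /andP[ij ->].
by rewrite eq_sym.
Qed.

Lemma Wiso_invK : cancel Wiso_inv Wiso.
Proof.
move=> [b t]; rewrite /Wiso_inv /= (linD WisoP) W11.
suff -> : Wiso (liftW t) = (0, t) by apply: pair_ext; rewrite /= ?simp0.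
elim/words_ind: t => [|k t t' IH IH'|w h].
- by rewrite (lin0 liftWP) (lin0 WisoP).
- by rewrite liftWP WisoP IH IH' inr_lin.
rewrite liftW_word //; case/lastP: w h => [//|w [i x]] h.
rewrite Winv_word_rcons; have [e|ne] := eqVneq i j; last first.
  rewrite untag_ltrN // W21 emb_word //; case/and3P: h => h1 h2 _.
  by rewrite /admissible h1 h2 /not_last map_rcons last_rcons.
subst i; rewrite untag_ltr; case/lastP: w h => [|w [i y]] h; first by rewrite W12.
have nil (u v : addB (tprods (not_last j))) l : (if rcons w l is [::] then u else v) = v.
  by case: (w).
rewrite nil W22 append_word //.
move: h; rewrite /admissible !map_rcons /not_last last_rcons -!cats1 -catA.
case: (map tag w) => [|i0 s] /=.
  by rewrite !andbT.
rewrite !cat_path /= !andbT => /and3P[-> -> ->] //.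
Qed.

Lemma tV_bal (a : B) (x : X j) b (t : words (not_head j)) :
  tV (a, x) (b, t) = tV (a * b, 0) (1, 0) + tV (0, ract x b) (1, 0)
    + tV (1, 0) (0, lact a (t : tprods _)) + tV (0, x) (0, t).
Proof.
have e1 : tV (a * b, 0) (1, 0) + tV (0, ract x b) (1, 0) = tV (a, x) (b, 0).
  rewrite -(@linD _ _ (fun u => tV u (1, 0)) (fun k u v => tensPl k u v _)).
  rewrite [_ + _](_ : _ = ract ((a, x) : addB (X j)) b); last first.
    by apply: pair_ext; rewrite /= ?simp0.
  rewrite tens_bal; congr (tens _ _).
  by apply: pair_ext; rewrite /= ?mulr1 // -[LHS]/(lact b (0 : tprods _)) simp0.
have e2 : tV (1, 0) (0, lact a (t : tprods _)) = tV (a, 0) (0, t).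
  rewrite -lact_inr -tens_bal; congr (tens _ _).
  by apply: pair_ext; rewrite /= ?simp0.
rewrite e1 e2 -addrA -(@linD _ _ (fun u => tV u (0, t)) (fun k u v => tensPl k u v _)).
rewrite [(a, 0) + _](_ : _ = (a, x)); last first.
  by apply: pair_ext; rewrite /= ?simp0.
rewrite -(@linD _ _ (fun u => tV (a, x) u) (fun k u v => tensPr k _ u v)).
by congr (tens _ _); apply: pair_ext; rewrite /= ?simp0.
Qed.

Lemma tW_bal (a : B) (x : X j) b (t : words (not_last j)) :
  tW (b, t) (a, x) = tW (1, 0) (b * a, 0) + tW (1, 0) (0, lact b x)
    + tW (0, ract (t : tprods _) a) (1, 0) + tW (0, t) (0, x).
Proof.
have e1 : tW (1, 0) (b * a, 0) + tW (1, 0) (0, lact b x) = tW (b, 0) (a, x).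
  rewrite -(@linD _ _ (fun u => tW (1, 0) u) (fun k u v => tensPr k _ u v)).
  rewrite [_ + _](_ : _ = lact b ((a, x) : addB (X j))); last first.
    by apply: pair_ext; rewrite /= ?simp0.
  rewrite -tens_bal; congr (tens _ _).
  by apply: pair_ext; rewrite /= ?mul1r // -[LHS]/(ract (0 : tprods _) b) simp0.
have e2 : tW (0, ract (t : tprods _) a) (1, 0) = tW (0, t) (a, 0).
  rewrite -ract_inr tens_bal; congr (tens _ _).
  by apply: pair_ext; rewrite /= ?simp0.
rewrite e1 e2 -addrA -(@linD _ _ (fun u => tW (0, t) u) (fun k u v => tensPr k _ u v)).
rewrite [(a, 0) + _](_ : _ = (a, x)); last first.
  by apply: pair_ext; rewrite /= ?simp0.
rewrite -(@linD _ _ (fun u => tW u (a, x)) (fun k u v => tensPl k u v _)).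
by congr (tens _ _); apply: pair_ext; rewrite /= ?simp0.
Qed.

Let VinvP k z z' : Viso_inv (k *: z + z') = k *: Viso_inv z + Viso_inv z'.
Proof.
rewrite /Viso_inv -/liftV addB2 liftVP.
rewrite [in LHS](_ : (_, 0) = k *: ((z.1, 0) : addB (X j)) + (z'.1, 0)).
  by rewrite tensPl addrACA -scalerDr.
by apply: pair_ext; rewrite /= ?simp0 ?scaler0.
Qed.

Let WinvP k z z' : Wiso_inv (k *: z + z') = k *: Wiso_inv z + Wiso_inv z'.
Proof.
rewrite /Wiso_inv -/liftW addB2 liftWP.
rewrite [in LHS](_ : (_, 0) = k *: ((z.1, 0) : addB (X j)) + (z'.1, 0)).
  by rewrite tensPr addrACA -scalerDr.
by apply: pair_ext; rewrite /= ?simp0 ?scaler0.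
Qed.

Lemma VisoK : cancel Viso Viso_inv.
Proof.
elim/tensor_ind => [|k t t' IH IH'|[a x] [b t]].
- by rewrite (lin0 VisoP) (lin0 VinvP).
- by rewrite VisoP VinvP IH IH'.
rewrite VfunE tV_bal /Viso_inv -/liftV /= !(linD liftVP) !addrA.
congr (_ + _ + _ + _).
- by rewrite liftV_word //= untag_ltr.
- suff H (u : words (not_head j)) : liftV (emb u) = tV (1, 0) (0, u) by exact: H.
  elim/words_ind: u => [|k u u' IH IH'|w h].
  + by rewrite emb0 (lin0 liftVP) tensDr0.
  + by rewrite embP liftVP IH IH' tV0P.
  case/and3P: (h) => h1 h2; rewrite emb_word // liftV_word; last first.
    by rewrite /admissible h1 h2.
  by case: w h h1 h2 => [//|[i y] w] h h1 h2; rewrite /not_head /= => ne; rewrite untag_ltrN.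
- elim/words_ind: t => [|k u u' IH IH'|w h].
  + by rewrite prepend0r (lin0 liftVP) tensDr0.
  + by rewrite prependPr liftVP IH IH' tV0P.
  case/and3P: (h) => h1 h2 h3; rewrite prepend_word // liftV_word.
    by rewrite /= untag_ltr; case: w h h1 h2 h3.
  move: h1 h2 h3; rewrite /admissible /not_head.
  by case: w h => [//|[i y] w] /= _ _ -> ne; rewrite eq_sym ne.
Qed.

Lemma WisoK : cancel Wiso Wiso_inv.
Proof.
elim/tensor_ind => [|k t t' IH IH'|[b t] [a x]].
- by rewrite (lin0 WisoP) (lin0 WinvP).
- by rewrite WisoP WinvP IH IH'.
rewrite WfunE tW_bal /Wiso_inv -/liftW /= !(linD liftWP) !addrA.
congr (_ + _ + _ + _).
- by rewrite liftW_word //= -[[:: _]]/(rcons [::] _) Winv_word_rcons untag_ltr.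
- suff H (u : words (not_last j)) : liftW (emb u) = tW (0, u) (1, 0) by exact: H.
  elim/words_ind: u => [|k u u' IH IH'|w h].
  + by rewrite emb0 (lin0 liftWP) tensDl0.
  + by rewrite embP liftWP IH IH' tW0P.
  case/and3P: (h) => h1 h2; rewrite emb_word // liftW_word; last first.
    by rewrite /admissible h1 h2.
  case/lastP: w h h1 h2 => [//|w [i y]] h h1 h2.
  by rewrite /not_last map_rcons last_rcons Winv_word_rcons => ne; rewrite untag_ltrN.
- elim/words_ind: t => [|k u u' IH IH'|w h].
  + by rewrite append0l (lin0 liftWP) tensDl0.
  + by rewrite appendPl liftWP IH IH' tW0P.
  case/and3P: (h) => h1 h2 h3; rewrite append_word // liftW_word.
    by rewrite Winv_word_rcons untag_ltr; case: w h h1 h2 h3.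
  move: h1 h2 h3; rewrite /admissible /not_last map_rcons.
  case: w h => [//|l w] /= _ _ h2 ne.
  by rewrite rcons_path h2 ne.
Qed.

(* lambda_j(T) = V_j (T (x) id) V_j^-1 for T commuting with the right action of
   B, and rho_j(T) = W_j (id (x) T) W_j^-1 for T commuting with the left one. *)
Definition lam (T : addB (X j) -> addB (X j)) (z : free_prod) : free_prod :=
  Viso (tens_map T id (Viso_inv z)).

Definition rho (T : addB (X j) -> addB (X j)) (z : free_prod) : free_prod :=
  Wiso (tens_map id T (Wiso_inv z)).

Lemma lam_tens (T : {linear addB (X j) -> addB (X j)}) x y :
  (forall x b, T (ract x b) = ract (T x) b) ->
  lam T (Viso (tV x y)) = Viso (tV (T x) y).
Proof.
move=> Tb; rewrite /lam VisoK tens_map_tens //.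
by move=> *; rewrite linearP.
Qed.

Lemma rho_tens (T : {linear addB (X j) -> addB (X j)}) x y :
  (forall b x, T (lact b x) = lact b (T x)) ->
  rho T (Wiso (tW y x)) = Wiso (tW y (T x)).
Proof.
move=> Tb; rewrite /rho WisoK tens_map_tens //.
by move=> *; rewrite linearP.
Qed.

End Action.

(* E_B(T) = P(T(1_B (+) 0)). *)
Definition vac_expect (T : free_prod -> free_prod) : B := (T (1, 0)).1.

End Words.
End Bimodules.

Variant side := Left | Right.

Definition is_left (s : side) : bool := if s is Left then true else false.

(* The unital homomorphism from B (x) B^op is given by its values
   [eps b1 b2] on the elementary tensors b1 (x) b2, i.e. by a bilinear map
   which is unital and multiplicative; note the reversed product in the second
   argument. *)
Record BBncps (K : fieldType) (A B : algType K) := {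
  eps : B -> B -> A;
  expect : {linear A -> B};
  epsPl : forall k a a' b, eps (k *: a + a') b = k *: eps a b + eps a' b;
  epsPr : forall k a b b', eps a (k *: b + b') = k *: eps a b + eps a b';
  eps1 : eps 1 1 = 1;
  epsM : forall a b a' b', eps a b * eps a' b' = eps (a * a') (b' * b);
  eps_injl : injective (fun b => eps b 1);
  eps_injr : injective (fun b => eps 1 b);
  expect_eps : forall b1 b2 T, expect (eps b1 b2 * T) = b1 * expect T * b2;
  expect_LR : forall b T, expect (T * eps b 1) = expect (T * eps 1 b)
}.

Section BiFree.
Variables (K : fieldType) (A B : algType K) (P : BBncps A B).

Definition opL (b : B) : A := eps P b 1.
Definition opR (b : B) : A := eps P 1 b.
Definition opT (s : side) : B -> A := if s is Left then opL else opR.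

Definition left_alg : set A := [set T | forall b, T * opR b = opR b * T].
Definition right_alg : set A := [set T | forall b, T * opL b = opL b * T].

Definition is_Bpair (x : side -> A) : Prop :=
  left_alg (x Left) /\ right_alg (x Right).

Definition is_subalgebra (C : set A) : Prop :=
  [/\ C 1, forall k a b, C a -> C b -> C (k *: a + b)
         & forall a b, C a -> C b -> C (a * b)].

Definition is_Bfaces (C : side -> set A) : Prop :=
  [/\ is_subalgebra (C Left), is_subalgebra (C Right),
      range opL `<=` C Left /\ C Left `<=` left_alg
    & range opR `<=` C Right /\ C Right `<=` right_alg].

(* Subalgebras are unital: both faces contain eps 1 1 = 1 anyway. *)
Definition gen_faces (x : side -> A) (s : side) : set A :=
  smallest is_subalgebra ([set x s] `|` range (opT s)).

(* f restricted to C is a unital homomorphism into the linear maps on M that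
   commute with the right action, and sends L_b to the left action of b
   (hence f 1 = id).  The values of f outside C are irrelevant. *)
Definition left_rep (C : set A) (M : bimodule B) (f : A -> {linear M -> M}) :
    Prop :=
  [/\ forall a v b, C a -> f a (ract v b) = ract (f a v) b,
      forall k a a' v, C a -> C a' -> f (k *: a + a') v = k *: f a v + f a' v,
      forall a a' v, C a -> C a' -> f (a * a') v = f a (f a' v)
    & forall b v, f (opL b) v = lact b v].

Definition right_rep (C : set A) (M : bimodule B) (f : A -> {linear M -> M}) :
    Prop :=
  [/\ forall a v b, C a -> f a (lact b v) = lact b (f a v),
      forall k a a' v, C a -> C a' -> f (k *: a + a') v = k *: f a v + f a' v,
      forall a a' v, C a -> C a' -> f (a * a') v = f a (f a' v)
    & forall b v, f (opR b) v = ract v b].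

Definition bifree_faces (I : choiceType) (C : I -> side -> set A) : Prop :=
  (forall j, is_Bfaces (C j)) /\
  exists (X : I -> bimodule B)
         (l r : forall j, A -> {linear addB (X j) -> addB (X j)}),
    [/\ forall j, left_rep (C j Left) (l j),
        forall j, right_rep (C j Right) (r j)
      & forall n (j : 'I_n -> I) (s : 'I_n -> side) (a : 'I_n -> A),
          (forall k, C (j k) (s k) (a k)) ->
          expect P (\prod_(k < n) a k) =
          vac_expect (\big[(fun S T => S \o T)/id]_(k < n)
            (if s k is Left then lam (l (j k) (a k)) else rho (r (j k) (a k))))].

Definition bifree (I : choiceType) (x : I -> side -> A) : Prop :=
  bifree_faces (fun j => gen_faces (x j)).

Definition Bmoment (x : side -> A) n (chi : 'I_n -> side)
    (tau : 'I_n.+1 -> side) (b : 'I_n.+1 -> B) : B :=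
  expect P
    ((\prod_(k < n) (opT (tau (widen_ord (leqnSn n) k))
                         (b (widen_ord (leqnSn n) k)) * x (chi k)))
     * opT (tau ord_max) (b ord_max)).

Definition identically_distributed (I : Type) (x : I -> side -> A) : Prop :=
  forall n (chi : 'I_n -> side) (tau : 'I_n.+1 -> side) (b : 'I_n.+1 -> B) j j',
  Bmoment (x j) chi tau b = Bmoment (x j') chi tau b.

End BiFree.

(* The norm cannot be the one of [normedModType]: as [numDomainType] is both a
   ring and a normed Z-module, the hierarchy does not allow a later structure
   that joins rings and normed modules.  Completeness is stated with Cauchy
   sequences. *)
HB.mixin Record isCStarAlg (R : realType) Q of GRing.Algebra R[i] Q := {
  star : Q -> Q;
  cnorm : Q -> R;
  starP : forall k (a b : Q), star (k *: a + b) = (k^*)%C *: star a + star b;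
  starM : forall a b : Q, star (a * b) = star b * star a;
  starK : involutive star;
  cnorm0_eq0 : forall a : Q, cnorm a = 0 -> a = 0;
  cnormD : forall a b : Q, cnorm (a + b) <= cnorm a + cnorm b;
  cnormZ : forall k (a : Q), cnorm (k *: a) = Normc.normc k * cnorm a;
  cnormM : forall a b : Q, cnorm (a * b) <= cnorm a * cnorm b;
  cnorm_star : forall a : Q, cnorm (star a * a) = cnorm a ^+ 2;
  cnorm_complete : forall s : nat -> Q,
    (forall e, 0 < e -> exists n0, forall m n,
       (n0 <= m)%N -> (n0 <= n)%N -> cnorm (s m - s n) < e) ->
    exists l, forall e, 0 < e -> exists n0, forall n,
       (n0 <= n)%N -> cnorm (s n - l) < e
}.

#[short(type="cstarAlgType")]
HB.structure Definition CStarAlg (R : realType) :=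
  { Q of isCStarAlg R Q & GRing.Algebra R[i] Q }.

Section QuantumPermutations.
Variables (R : realType) (N : nat).

Definition magic_unitary (Q : cstarAlgType R) (u : 'I_N -> 'I_N -> Q) : Prop :=
  [/\ forall i j, star (u i j) = u i j,
      forall i j, u i j * u i j = u i j,
      forall k, \sum_i u i k = 1
    & forall k, \sum_j u k j = 1].

Definition star_hom_sending (Q D : cstarAlgType R) (u : 'I_N -> 'I_N -> Q)
    (v : 'I_N -> 'I_N -> D) (f : {lrmorphism Q -> D}) : Prop :=
  (forall a, f (star a) = star (f a)) /\ (forall i j, f (u i j) = v i j).

(* (Q, u) is C(S_N^+) with its canonical generators. *)
Definition is_CSNplus (Q : cstarAlgType R) (u : 'I_N -> 'I_N -> Q) : Prop :=
  magic_unitary u /\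
  forall (D : cstarAlgType R) (v : 'I_N -> 'I_N -> D), magic_unitary v ->
  exists f : {lrmorphism Q -> D}, star_hom_sending u v f /\
    forall g : {lrmorphism Q -> D}, star_hom_sending u v g -> g =1 f.

End QuantumPermutations.

Section SChi.
Variables (n : nat) (chi : 'I_n -> side).

(* The left positions in increasing order, then the right ones in decreasing
   order; s_chi t is the t-th entry (positions are numbered from 0). *)
Definition chi_order : seq 'I_n :=
  [seq k <- enum 'I_n | is_left (chi k)] ++
  rev [seq k <- enum 'I_n | ~~ is_left (chi k)].

Definition s_fun (t : 'I_n) : 'I_n := nth t chi_order t.

Lemma s_fun_inj : injective s_fun.
Proof.
have uo : perm_eq chi_order (enum 'I_n).
  rewrite /chi_order perm_sym -(perm_filterC (fun k => is_left (chi k))).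
  by rewrite perm_cat2l perm_sym perm_rev.
have sz : size chi_order = n by rewrite (perm_size uo) size_enum_ord.
move=> t t'; rewrite /s_fun (set_nth_default t) ?sz // => /eqP.
rewrite nth_uniq ?sz //; first by move/eqP/val_inj.
by rewrite (perm_uniq uo) enum_uniq.
Qed.

Definition s_chi : 'S_n := perm s_fun_inj.

End SChi.

Definition u_chi (Q : pzSemiRingType) (N n : nat) (u : 'I_N -> 'I_N -> Q)
    (chi : 'I_n -> side) (I J : 'I_n -> 'I_N) : Q :=
  \prod_(t < n) u (I (s_chi chi t)) (J (s_chi chi t)).

Definition quantum_bi_exchangeable (R : realType) (A : algType R[i])
    (phi : {scalar A}) (N : nat) (x : 'I_N -> side -> A)
    (Q : cstarAlgType R) (u : 'I_N -> 'I_N -> Q) : Prop :=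
  forall n (chi : 'I_n -> side) (J : 'I_n -> 'I_N),
    phi (\prod_(k < n) x (J k) (chi k)) *: (1 : Q) =
    \sum_(I : {ffun 'I_n -> 'I_N})
      phi (\prod_(k < n) x (I k) (chi k)) *: u_chi u chi I J.

(* Main.v *)
(* Realize the pairs as left and right operators on the free product X of the
   X_j.  Quantum permutations coact on X by
     xi_(i1) (x) .. (x) xi_(ik) |->
       sum_J xi_(j1) (x) .. (x) xi_(jk) (x) u_(j1 i1) .. u_(jk ik);
   admissible words go to admissible words because distinct projections in a row
   of u are orthogonal.  Under this coaction lambda_j(x^l) becomes
   sum_i lambda_i(x^l) (x) (left multiplication by u_ij) and rho_j(x^r) becomes
   sum_i rho_i(x^r) (x) (right multiplication by u_ij).  Applied to the vacuum
   vector, which is fixed, a product of such operators picks up the u_ij of its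
   left factors in increasing order followed by those of its right factors in
   decreasing order, that is u_IJ^chi, and the vacuum expectation is invariant.
   The spaces X_j may differ, but the identical distribution makes the vectors
   obtained from the vacuum by the same word in the faces correspond to each
   other, and nothing else is needed.

   The orthogonality is proved from the C*-identity alone: for a member p of a
   finite family of projections e_j of sum 1, the p e_j p with e_j <> p sum to
   zero, so that p + z b is a contraction for z ^ 4 = 1, where b is a multiple of
   p e_j p; a Liouville-type estimate on (p + z b) ^ n then gives b = 0. *)

Require Import Defs.
From HB Require Import structures.
From mathcomp Require Import all_boot all_order all_algebra perm.
From mathcomp Require Import ring lra.
From mathcomp Require Import complex boolp classical_sets reals.

Set Implicit Arguments.
Unset Strict Implicit.
Unset Printing Implicit Defensive.

Import Order.TTheory GRing.Theory Num.Theory.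
Local Open Scope ring_scope.

(** * Orthogonality in magic unitaries *)

Section CStarNorm.
Variables (R : realType) (Q : cstarAlgType R).
Implicit Types (a b p : Q) (z : R[i]).

Lemma cnormN a : cnorm (- a) = cnorm a.
Proof.
by rewrite -scaleN1r cnormZ /Normc.normc /= oppr0 sqrrN expr1n expr0n addr0 sqrtr1 mul1r.
Qed.

Lemma cnorm0 : cnorm (0 : Q) = 0.
Proof. by rewrite -(scale0r (0 : Q)) cnormZ Normc.normc0 mul0r. Qed.

Lemma cnorm_ge0 a : 0 <= cnorm a.
Proof. by have := cnormD a (- a); rewrite subrr cnorm0 cnormN; lra. Qed.

Lemma cnormB a b : cnorm (a - b) <= cnorm a + cnorm b.
Proof. by rewrite -(cnormN b) cnormD. Qed.

Lemma cnormM_le1 a b : cnorm a <= 1 -> cnorm b <= 1 -> cnorm (a * b) <= 1.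
Proof.
by move=> a1 b1; apply: le_trans (cnormM a b) _; rewrite mulr_ile1 ?cnorm_ge0.
Qed.

Lemma cnorm_natZ n a : cnorm ((n%:R : R[i]) *: a) = n%:R * cnorm a.
Proof.
rewrite cnormZ -(rmorph_nat (real_complex R)) /Normc.normc /=.
by rewrite expr0n addr0 sqrtr_sqr ger0_norm.
Qed.

Lemma cnorm_sum (I : Type) (r : seq I) (P : pred I) (F : I -> Q) :
  cnorm (\sum_(i <- r | P i) F i) <= \sum_(i <- r | P i) cnorm (F i).
Proof.
elim/big_rec2: _ => [|i x y _ le_xy]; first by rewrite cnorm0.
by apply: le_trans (cnormD _ _) _; rewrite lerD2l.
Qed.

Lemma star1 : star (1 : Q) = 1.
Proof.
have := starM (star (1 : Q)) 1.
by rewrite mulr1 starK mulr1.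
Qed.

Lemma starD a b : star (a + b) = star a + star b.
Proof.
by have := starP 1 a b; rewrite !scale1r => ->; rewrite rmorph1 scale1r.
Qed.

Lemma star0 : star (0 : Q) = 0.
Proof. by apply: (addIr (star 0)); rewrite -starD !add0r. Qed.

Lemma starZ z a : star (z *: a) = (z^*)%C *: star a.
Proof. by rewrite -[_ *: a]addr0 starP star0 addr0. Qed.

Lemma starN a : star (- a) = - star a.
Proof. by rewrite -scaleN1r starZ rmorphN1 scaleN1r. Qed.

Definition projection p := star p = p /\ p * p = p.

Lemma projection_compl p : projection p -> projection (1 - p).
Proof.
move=> [sp pp]; split; first by rewrite starD starN star1 sp.
by rewrite mulrBr mulr1 mulrBl mul1r pp subrr subr0.
Qed.

Lemma cnorm_projection p : projection p -> cnorm p <= 1.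
Proof.
move=> [sp pp]; have := cnorm_star p; rewrite sp pp.
by have := cnorm_ge0 p; nra.
Qed.

End CStarNorm.

(** * Rigidity of the unit [p] of a corner as an extreme point of the unit ball *)

Section Corner.
Variables (R : realType) (Q : cstarAlgType R) (p b : Q).
Hypotheses (pp : projection p) (pb : p * b = b) (bp : b * p = b).
Hypotheses (sb : star b = b).
Hypotheses (normDb : cnorm (p + b) <= 1) (normBb : cnorm (p - b) <= 1).

Local Notation beta := (cnorm b).
Local Notation i := ('i%C : R[i]).

Let beta_ge0 : 0 <= beta. Proof. exact: cnorm_ge0. Qed.

(** [p + b * b] is the average of the squares of the contractions [p + b] and [p - b], whose cross
    terms cancel. *)
Let normDbb : cnorm (p + b * b) <= 1.
Proof.
have [_ idp] := pp.
have e : 2%:R *: (p + b * b) = (p + b) * (p + b) + (p - b) * (p - b).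
  rewrite mulrDl mulrBl addrACA -mulrDr -mulrBr.
  by rewrite addrACA subrr addr0 opprD opprK addrACA subrr add0r !mulrDr idp -mulr2n
     -[b * b + _]mulr2n -mulrnDl scaler_nat.
have := cnorm_natZ 2 (p + b * b); rewrite e.
have := cnormD ((p + b) * (p + b)) ((p - b) * (p - b)).
have := cnormM_le1 normDb normDb; have := cnormM_le1 normBb normBb.
by lra.
Qed.

(** The powers 1 and -1 are the hypotheses. For [z] equal to [i] or [- i], the self-adjointness of
    [b] gives [star (p + z *: b) * (p + z *: b) = p + b * b], and the C*-identity applies. *)
Let contraction k : cnorm (p + (i ^+ k) *: b) <= 1.
Proof.
have i4 : i ^+ 4 = 1 by rewrite (exprM _ 2 2) sqr_i sqrrN expr1n.
have iE : i ^+ k = i ^+ (k %% 4).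
  by rewrite {1}(divn_eq k 4) exprD mulnC exprM i4 expr1n mul1r.
rewrite iE; have : (k %% 4 < 4)%N by rewrite ltn_mod.
have [sp idp] := pp.
have normZ (z : R[i]) : z = i \/ z = - i -> cnorm (p + z *: b) <= 1.
  move=> zE; have zc : (z^*)%C = - z.
    by case: zE => ->; apply/eqP; rewrite eq_complex /= ?oppr0 !eqxx.
  have zz : z * z = - 1 by case: zE => ->; rewrite ?mulrNN -expr2 sqr_i.
  suff e : star (p + z *: b) * (p + z *: b) = p + b * b.
    have := cnorm_star (p + z *: b); rewrite e; have := normDbb.
    by have := cnorm_ge0 (p + z *: b); nra.
  rewrite starD starZ sp sb zc scaleNr mulrBl !mulrDr idp -!scalerAl -!scalerAr pb bp.
  by rewrite scalerA zz scaleN1r opprB addrA [X in X - _]addrAC addrK.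
case: (k %% 4)%N => [|[|[|[|//]]]] _.
- by rewrite expr0 scale1r.
- by apply: normZ; left.
- by rewrite sqr_i scaleN1r.
- by apply: normZ; right; rewrite exprS sqr_i mulrN1.
Qed.

(** This is the power [(p + z b) ^ n] in the corner of [p], so the zeroth power is [p] and not 1. *)
Let W (z : R[i]) n := iter n (fun w => w + z *: (b * w)) p.

Let WS z n : W z n.+1 = W z n + z *: (b * W z n).
Proof. by []. Qed.

Let pW z n : p * W z n = W z n.
Proof.
elim: n => [|n IH]; first by case: pp.
by rewrite WS mulrDr -scalerAr mulrA pb IH.
Qed.

Let normW k n : cnorm (W (i ^+ k) n) <= 1.
Proof.
elim: n => [|n IH]; first exact: cnorm_projection.
rewrite WS -{1}(pW _ n) scalerAl -mulrDl.
exact: cnormM_le1 (contraction k) IH.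
Qed.

(* [filt r n] is the sum of the terms of degree [m = r (mod 4)] in the binomial
   expansion of [(p + b) ^ n]; averaging over the fourth roots of unity shows
   that its norm is at most one. *)
Let filt r n : Q :=
  4^-1 *: \sum_(k < 4) (i ^+ (3 * k * r)) *: W (i ^+ k) n.

Let i4 k : i ^+ (4 * k) = 1.
Proof. by rewrite exprM (exprM _ 2 2) sqr_i sqrrN !expr1n. Qed.

Let norm_i k : Normc.normc (i ^+ k) = 1.
Proof.
elim: k => [|k IH]; first by rewrite expr0 Normc.normc1.
by rewrite exprS Normc.normcM IH /Normc.normc /= expr0n expr1n add0r sqrtr1 mulr1.
Qed.

Let norm_filt r n : cnorm (filt r n) <= 1.
Proof.
have e : 4%:R *: filt r n = \sum_(k < 4) (i ^+ (3 * k * r)) *: W (i ^+ k) n.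
  by rewrite /filt scalerA divff ?scale1r // pnatr_eq0.
have := cnorm_natZ 4 (filt r n); rewrite e.
have := cnorm_sum (index_enum 'I_4) predT (fun k => (i ^+ (3 * k * r)) *: W (i ^+ k) n).
have : \sum_(k < 4) cnorm (i ^+ (3 * k * r) *: W (i ^+ k) n) <= \sum_(k < 4) 1.
  by apply: ler_sum => k _; rewrite cnormZ norm_i mul1r.
by rewrite sumr_const card_ord /=; lra.
Qed.

Let filtS r n : filt r.+1 n.+1 = filt r.+1 n + b * filt r n.
Proof.
rewrite /filt -scalerAr mulr_sumr -scalerDr -big_split; congr (_ *: _).
apply: eq_bigr => k _; rewrite WS scalerDr -scalerAr; congr (_ + _).
(* The exponent [3 * k * r] stands for [- k * r], as [i] has order 4: the extra [3 * k] cancels the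
   factor [i ^+ k] contributed by [W]. *)
by rewrite scalerA -exprD mulnS addnAC -mulSnr exprD i4 mul1r.
Qed.

(** Periodicity makes the residue 3 the predecessor of the residue 0 in the recurrence [filtS]. *)
Let filt4 r n : filt (r + 4) n = filt r n.
Proof.
congr (_ *: _); apply: eq_bigr => k _.
by rewrite mulnDr exprD [(3 * k * 4)%N]mulnC i4 mulr1.
Qed.

(** The coefficient of [p] is the sum of a nontrivial character of the group of order 4. *)
Let filt0 r : (0 < r < 4)%N -> filt r 0 = 0.
Proof.
move=> r_lt; rewrite /filt -scaler_suml.
rewrite !big_ord_recl big_ord0 /= !(mulnA, muln0, mul0n, muln1, expr0).
suff -> : 1 + (i ^+ (3 * r) + (i ^+ (6 * r) + (i ^+ (9 * r) + 0))) = 0 :> R[i].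
  by rewrite scale0r scaler0.
have -> : i ^+ (3 * r) = (- i) ^+ r by rewrite exprM exprS sqr_i mulrN1.
have -> : i ^+ (6 * r) = (-1) ^+ r.
  by rewrite exprM (exprM _ 2 3) sqr_i; congr (_ ^+ _); ring.
have -> : i ^+ (9 * r) = i ^+ r.
  by rewrite exprM (exprS i 8) (i4 2) mulr1.
have ii : i * i = -1 by rewrite -expr2 sqr_i.
case: r r_lt => [//|[_|[_|[_|//]]]];
  rewrite ?(exprS, expr0, mulr1, mulrN1, mulNr, mulrN, opprK, ii).
- by rewrite addr0; ring.
- by rewrite addr0; ring.
- by rewrite addr0; ring.
Qed.

Let filt00 : filt 0 0 = p.
Proof.
rewrite /filt -scaler_suml; under eq_bigr do rewrite muln0 expr0.
by rewrite sumr_const card_ord scalerA mulVf ?scale1r // pnatr_eq0.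
Qed.

Let norm_bM x c : cnorm x <= c -> cnorm (b * x) <= beta * c.
Proof. by move=> xc; apply: le_trans (cnormM b x) _; rewrite ler_wpM2l. Qed.

(** The trivial bound on the residue 1 is fed through [filtS] once around the cycle 2, 3, 0, 1. Each
    summation over [n] acts like an integration, whence the denominators 1, 2, 6, 24; at 0 and 1 the
    leading terms [p] and [n b] are subtracted first. *)
Let bound2 n : cnorm (filt 2 n) <= n%:R * beta.
Proof.
elim: n => [|n IH]; first by rewrite filt0 // cnorm0 mul0r.
rewrite filtS -natr1; apply: le_trans (cnormD _ _) _.
by have := norm_bM (norm_filt 1 n); lra.
Qed.

Let bound3 n : cnorm (filt 3 n) <= (n%:R * beta) ^+ 2 / 2.
Proof.
elim: n => [|n IH]; first by rewrite filt0 // cnorm0 mul0r expr0n mul0r.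
rewrite filtS -natr1; apply: le_trans (cnormD _ _) _.
have := norm_bM (bound2 n); have := sqr_ge0 beta.
by move: (n%:R : R) beta IH => m t IH; lra.
Qed.

Let bound0 n : cnorm (filt 0 n - p) <= (n%:R * beta) ^+ 3 / 6.
Proof.
elim: n => [|n IH]; first by rewrite filt00 subrr cnorm0 mul0r expr0n mul0r.
have -> : filt 0 n.+1 = filt 0 n + b * filt 3 n.
  by rewrite -(filt4 0 n.+1) filtS (filt4 0).
rewrite addrAC -natr1; apply: le_trans (cnormD _ _) _.
have := norm_bM (bound3 n); have t3 := exprn_ge0 3 beta_ge0.
have := mulr_ge0 (ler0n R n) t3; have := t3.
by move: (n%:R : R) beta IH => m t IH; lra.
Qed.

Let bound1 n : cnorm (filt 1 n - (n%:R : R[i]) *: b) <= (n%:R * beta) ^+ 4 / 24.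
Proof.
elim: n => [|n IH]; first by rewrite filt0 // scale0r subrr cnorm0 mul0r expr0n mul0r.
have -> : filt 1 n.+1 - (n.+1%:R : R[i]) *: b =
    filt 1 n - (n%:R : R[i]) *: b + b * (filt 0 n - p).
  by rewrite filtS -natr1 scalerDl scale1r mulrBr bp opprD addrACA.
rewrite -natr1; apply: le_trans (cnormD _ _) _.
have := norm_bM (bound0 n); have t4 := exprn_ge0 4 beta_ge0.
have := mulr_ge0 (ler0n R n) t4; have := mulr_ge0 (sqr_ge0 (n%:R : R)) t4; have := t4.
by move: (n%:R : R) beta IH => m t IH; lra.
Qed.

(* [filt 1 n] is [n b] up to an error of norm at most [(n beta) ^ 4 / 24], so
   [n beta <= 1 + (n beta) ^ 4 / 24], which fails when [n beta] lies between
   [5 / 4] and [9 / 4]. *)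
Lemma corner_eq0 : b = 0.
Proof.
apply: cnorm0_eq0; apply/eqP; rewrite eq_le beta_ge0 andbT leNgt; apply/negP => beta_gt0.
have growth n : n%:R * beta <= 1 + (n%:R * beta) ^+ 4 / 24.
  rewrite -cnorm_natZ; have := bound1 n; have := norm_filt 1 n.
  have := cnormB (filt 1 n) (filt 1 n - n%:R *: b).
  by rewrite opprB addrC subrK cnorm_natZ; lra.
(* [filt 1 1] is [b]. Steps of length at most 1 ensure that the first multiple of [beta] to reach
   [5 / 4] does not exceed [9 / 4]. *)
have beta_le1 : beta <= 1.
  have := norm_filt 1 1; rewrite filtS filt00 bp filt0 // add0r //.
have ex : exists n, 5 / 4 <= n%:R * beta.
  have /archi_boundP h : 0 <= 5 / 4 / beta by apply: divr_ge0; [lra|exact: beta_ge0].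
  by exists (Num.bound (5 / 4 / beta)); rewrite -ler_pdivrMr // ltW.
have := ex_minnP ex => -[[|n] hn min_n]; first by move: hn; rewrite mul0r; lra.
have lt_n : n%:R * beta < 5 / 4.
  by rewrite ltNge; apply/negP => /min_n; rewrite ltnn.
have e : n.+1%:R * beta = n%:R * beta + beta by rewrite -natr1 mulrDl mul1r.
have := growth n.+1; move: hn; rewrite e.
move: (n%:R * beta) lt_n => t lt_n hn.
have : t + beta <= 9 / 4 by lra.
move: (t + beta) hn => s s_ge s_le.
(* Multiplied by [s] and by [s ^+ 2], this inequality bounds [s ^+ 4] by lower powers and in the end
   by a linear function of [s], which contradicts [growth]. *)
have q : 0 <= (s - 5 / 4) * (9 / 4 - s) by apply: mulr_ge0; lra.
have s_ge0 : 0 <= s by lra.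
have := mulr_ge0 (sqr_ge0 s) q; have := mulr_ge0 s_ge0 q; lra.
Qed.

End Corner.

(** * Mutual orthogonality of projections with sum 1 *)

Section MagicUnitary.
Variables (R : realType) (Q : cstarAlgType R).

Lemma compression_norm (p e : Q) : projection p -> projection e ->
  cnorm (p - p * e * p) <= 1.
Proof.
move=> pp ee; have -> : p - p * e * p = p * (1 - e) * p.
  by rewrite mulrBr mulr1 mulrBl; case: pp => _ ->.
by rewrite !cnormM_le1 ?cnorm_projection //; apply: projection_compl.
Qed.

Lemma projection_orthogonal (T : finType) (e : T -> Q) :
  (forall i, projection (e i)) -> \sum_i e i = 1 ->
  forall i j, i != j -> e i * e j = 0.
Proof.
move=> pe e1 i j ij; set p := e i.
have [sp pp] := pe i; have [sj jj] := pe j.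
pose x k := p * e k * p.
have px k : p * x k = x k by rewrite /x !mulrA pp.
have xp k : x k * p = x k by rewrite /x -!mulrA pp.
have sx k : star (x k) = x k.
  by rewrite /x !starM sp; case: (pe k) => -> _; rewrite mulrA.
(* Compressing the identity [\sum_k e k = 1] by [p] gives [p] on the right, which cancels the term
   [x i = p]. *)
have x0 : \sum_(k | k != i) x k = 0.
  rewrite /x -mulr_suml -mulr_sumr.
  move: e1; rewrite (bigD1 i) //= => /(canRL (addKr _)) ->.
  by rewrite mulrDr mulr1 mulrN pp addNr mul0r.
(* As [x j] is minus the sum of the [m] other [x k], [m p + x j] is a sum of [m] contractions
   [p - x k]. One more copy of [p] makes the bound the same for [x j] and [- x j], and keeps the
   divisor below nonzero. *)
pose m := #|[pred k | (k != i) && (k != j)]|.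
have sumE : (m%:R : R[i]) *: p + x j = \sum_(k | (k != i) && (k != j)) (p - x k).
  move: x0; rewrite (bigD1 j) ?(eq_sym j) //= sumrB sumr_const => /(canRL (addrK _)) ->.
  by rewrite scaler_nat sub0r.
have boundD : cnorm ((m.+1%:R : R[i]) *: p + x j) <= m.+1%:R.
  rewrite -natr1 scalerDl scale1r addrAC sumE.
  apply: le_trans (cnormD _ _) _; rewrite -natr1 lerD ?cnorm_projection //.
  apply: le_trans (cnorm_sum _ _ _) _.
  have -> : m%:R = \sum_(k | (k != i) && (k != j)) 1 :> R by rewrite sumr_const.
  by apply: ler_sum => k _; apply: compression_norm.
have boundB : cnorm ((m.+1%:R : R[i]) *: p - x j) <= m.+1%:R.
  rewrite -natr1 scalerDl scale1r -addrA.
  apply: le_trans (cnormD _ _) _; rewrite -natr1 lerD ?compression_norm //.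
  by rewrite cnorm_natZ ler_piMr // cnorm_projection.
pose b : Q := m.+1%:R^-1 *: x j.
have bE : (m.+1%:R : R[i]) *: b = x j by rewrite scalerA divff ?scale1r // pnatr_eq0.
have b0 : b = 0.
  apply: (@corner_eq0 _ _ p) => //.
  - by rewrite -scalerAr px.
  - by rewrite -scalerAl xp.
  - by rewrite starZ sx fmorphV rmorph_nat.
  - by rewrite -(ler_pM2l (ltr0Sn R m)) -cnorm_natZ scalerDr bE mulr1.
  - by rewrite -(ler_pM2l (ltr0Sn R m)) -cnorm_natZ scalerBr bE mulr1.
(* [x j] is [star (e j * p) * (e j * p)]. *)
have : cnorm (e j * p) ^+ 2 = 0.
  rewrite -cnorm_star starM sp sj mulrA -[p * _ * _]mulrA jj -/(x j) -bE b0.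
  by rewrite scaler0 cnorm0.
move/eqP; rewrite sqrf_eq0 => /eqP/cnorm0_eq0 /(congr1 star).
by rewrite starM sp sj star0.
Qed.

Variables (N : nat) (u : 'I_N -> 'I_N -> Q).
Hypothesis mu : magic_unitary u.

Let proj i j : projection (u i j).
Proof. by case: mu => su uu _ _; split; [exact: su | exact: uu]. Qed.

Lemma magic_column i i' j : u i j * u i' j = if i == i' then u i j else 0.
Proof.
have [_ uu s1 _] := mu; case: eqVneq => [<-//|ne].
exact: (@projection_orthogonal _ (fun i => u i j)).
Qed.

Lemma magic_row i j j' : j != j' -> u i j * u i j' = 0.
Proof.
have [_ _ _ s1] := mu.
exact: (@projection_orthogonal _ (u i)).
Qed.

End MagicUnitary.

(** * The action on elementary tensors of the free product *)

Section FreeProductAction.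
Variables (K : fieldType) (B : algType K) (I : choiceType) (X : I -> bimodule B).
Local Notation letter := {i : I & X i}.
Local Notation FP := (free_prod X).

Lemma lact0 (M : bimodule B) b : lact b (0 : M) = 0.
Proof. exact: (lin0 (fun k => @lactPr _ _ M k b)). Qed.

Lemma ract0 (M : bimodule B) b : ract (0 : M) b = 0.
Proof. exact: (@lin0 _ _ _ (fun x : M => ract x b) (fun k a => @ractPl _ _ M k b a)). Qed.

Lemma lact0l (M : bimodule B) (x : M) : lact 0 x = 0.
Proof. exact: (@lin0 _ _ _ (fun b : B => lact b x) (fun k a b => lactPl k a b x)). Qed.

Lemma ract0r (M : bimodule B) (x : M) : ract x 0 = 0.
Proof. exact: (@lin0 _ _ _ (fun b : B => ract x b) (fun k a b => ractPr k a b x)). Qed.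

(* The elementary tensor of a word in the free product, with the empty word sent
   to the vacuum vector; [0] on words with equal consecutive indices. *)
Definition vec (w : seq letter) : FP :=
  if w is [::] then (1, 0) else (0, word xpredT w).

Lemma vec_cat_lin u i k (x y : X i) v :
  vec (u ++ ltr (k *: x + y) :: v) = k *: vec (u ++ ltr x :: v) + vec (u ++ ltr y :: v).
Proof.
have vecE l : vec (u ++ l :: v) = (0, word xpredT (u ++ l :: v)) by case: u.
by rewrite !vecE wordP; apply: (@inr_lin _ _ (tprods X xpredT)).
Qed.

Lemma vec_cat0 u i v : vec (u ++ ltr (0 : X i) :: v) = 0.
Proof.
exact: (@lin0 _ _ _ (fun x : X i => vec (u ++ ltr x :: v))
  (fun k x y => vec_cat_lin u k x y v)).
Qed.

Lemma vec_head0 i v : vec (ltr (0 : X i) :: v) = 0.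
Proof. exact: (vec_cat0 [::]). Qed.

Lemma vec_last0 i v : vec (rcons v (ltr (0 : X i))) = 0.
Proof. by rewrite -cats1 vec_cat0. Qed.

Lemma vec_nonadmissible w : ~~ sorted (fun i j => i != j) (map tag w) -> vec w = 0.
Proof.
case: w => [//|l w] h; rewrite /vec word0 // /admissible /=.
by apply: contra h => /andP[].
Qed.

Lemma lact_vec b i (x : X i) w : lact b (vec (ltr x :: w)) = vec (ltr (lact b x) :: w).
Proof. by rewrite /vec lact_inr lact_word. Qed.

Lemma ract_vec b i (x : X i) w :
  ract (vec (rcons w (ltr x))) b = vec (rcons w (ltr (ract x b))).
Proof.
have vecE y : vec (rcons w y) = (0, word xpredT (rcons w y)) by case: w.
by rewrite !vecE ract_inr ract_word ractw_rcons.
Qed.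

Lemma lact_vac b : lact b (vec [::]) = (b, 0).
Proof. by apply: pair_ext; [exact: mulr1|exact: (@lact0 (tprods X xpredT))]. Qed.

Lemma ract_vac b : ract (vec [::]) b = (b, 0).
Proof. by apply: pair_ext; [exact: mul1r|exact: (@ract0 (tprods X xpredT))]. Qed.

Definition starts (j : I) (w : seq letter) : bool :=
  if w is l :: _ then tag l == j else false.

Definition ends (j : I) (w : seq letter) : bool :=
  if w is l :: w' then tag (last l w') == j else false.

Section Action.
Variable j : I.

(* The image under [V_j] of [a (x) w], and below that of [w (x) a] under [W_j],
   where [w] does not start, respectively end, with a letter of index [j]. *)
Definition left_split (a : addB (X j)) (w : seq letter) : FP :=
  lact a.1 (vec w) + vec (ltr a.2 :: w).

Definition right_split (a : addB (X j)) (w : seq letter) : FP :=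
  ract (vec w) a.1 + vec (rcons w (ltr a.2)).

Lemma left_split_fst b w : left_split (b, 0) w = lact b (vec w).
Proof. by rewrite /left_split vec_head0 addr0. Qed.

Lemma left_split_snd (x : X j) w : left_split (0, x) w = vec (ltr x :: w).
Proof. by rewrite /left_split lact0l add0r. Qed.

Lemma right_split_fst b w : right_split (b, 0) w = ract (vec w) b.
Proof. by rewrite /right_split vec_last0 addr0. Qed.

Lemma right_split_snd (x : X j) w : right_split (0, x) w = vec (rcons w (ltr x)).
Proof. by rewrite /right_split ract0r add0r. Qed.

Lemma Vfun_vac a : Vfun a ((1, 0) : addB (tprods X (not_head j))) = left_split a [::].
Proof.
case: a => b x; rewrite /left_split lact_vac; apply: pair_ext.
  by rewrite /= mulr1 addr0.
rewrite Vfun2 /= ract1 add0r.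
rewrite -[words_lact b 0]/(lact b (0 : tprods X (not_head j))) lact0.
by rewrite (lin0 (@embP _ _ _ X _)) (lin0 (@prependPr _ _ _ X _ _ x)) !addr0.
Qed.

Lemma Vfun_word a w : admissible (not_head j) (map tag w) ->
  Vfun a ((0, word (not_head j) w) : addB (tprods X (not_head j))) = left_split a w.
Proof.
case: a => b x h; have w0 : w != [::] by case: w h.
have vecE : vec w = (0, word xpredT w) by case: w w0 {h}.
rewrite /left_split vecE lact_inr; apply: pair_ext; first by rewrite /= mulr0 addr0.
rewrite Vfun2 /= ract0r (lin0 (fun k x y => word1P k x y xpredT)) add0r.
rewrite -[words_lact b _]/(lact b (word (not_head j) w : tprods X (not_head j))) lact_word.
rewrite prepend_word // emb_word ?tag_lactw //.
by rewrite -[words_lact b _]/(lact b (word xpredT w : tprods X xpredT)) lact_word.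
Qed.

(** The point is that [y] does not depend on [a]: an operator on [X_j] then acts on the split
    through [a] alone. If [w] has equal consecutive indices, both sides vanish and [y] is 0. *)
Lemma left_split_image w : ~~ starts j w ->
  exists y, forall a, left_split a w = Viso (tens a y).
Proof.
case: w => [_|l w ne] /=.
  by exists (1, 0) => a; rewrite Viso_tens Vfun_vac.
have [h|h] := boolP (sorted (fun i k => i != k) (map tag (l :: w))).
  exists (0, word (not_head j) (l :: w)) => a; rewrite Viso_tens Vfun_word //.
  by rewrite /admissible h /not_head.
exists 0 => a; rewrite tensDr0 (lin0 (@VisoP _ _ _ X j)).
rewrite /left_split !vec_nonadmissible ?lact0 ?addr0 //=.
by apply: contra h => /andP[].
Qed.

Lemma Wfun_vac a : Wfun ((1, 0) : addB (tprods X (not_last j))) a = right_split a [::].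
Proof.
case: a => b x; rewrite /right_split ract_vac; apply: pair_ext.
  by rewrite /= mul1r addr0.
rewrite Wfun2 /= lact1 add0r.
rewrite -[words_ract 0 b]/(ract (0 : tprods X (not_last j)) b) ract0.
rewrite (lin0 (@embP _ _ _ X _)) addr0.
by rewrite (@lin0 _ _ _ (fun t => append t x) (@appendPl _ _ _ X _ _ x)) addr0.
Qed.

Lemma Wfun_word a w : admissible (not_last j) (map tag w) ->
  Wfun ((0, word (not_last j) w) : addB (tprods X (not_last j))) a = right_split a w.
Proof.
case: a => b x h; have w0 : w != [::] by case: w h.
have vecE v : v != [::] -> vec v = (0, word xpredT v) by case: v.
rewrite /right_split !vecE //; last by case: (w).
rewrite (@ract_inr _ _ (tprods X xpredT)); apply: pair_ext; first by rewrite /= mul0r addr0.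
rewrite Wfun2 /= lact0l (lin0 (fun k x y => word1P k x y xpredT)) add0r.
rewrite -[words_ract _ b]/(ract (word (not_last j) w : tprods X (not_last j)) b) ract_word.
rewrite append_word // emb_word ?tag_ractw //.
by rewrite -[words_ract _ b]/(ract (word xpredT w : tprods X xpredT) b) ract_word.
Qed.

Lemma right_split_image w : ~~ ends j w ->
  exists y, forall a, right_split a w = Wiso (tens y a).
Proof.
case: w => [_|l w ne] /=.
  by exists (1, 0) => a; rewrite Wiso_tens Wfun_vac.
have [h|h] := boolP (sorted (fun i k => i != k) (map tag (l :: w))).
  exists (0, word (not_last j) (l :: w)) => a; rewrite Wiso_tens Wfun_word //.
  by rewrite /admissible h /not_last /= last_map.
exists 0 => a; rewrite tensDl0 (lin0 (@WisoP _ _ _ X j)).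
rewrite /right_split !vec_nonadmissible ?ract0 ?addr0 //.
by apply: contra h; rewrite map_rcons /= rcons_path => /andP[].
Qed.

Section LeftOperator.
Variable T : {linear addB (X j) -> addB (X j)}.
Hypothesis Tb : forall x b, T (ract x b) = ract (T x) b.

Lemma lam_left_split a w : ~~ starts j w -> lam T (left_split a w) = left_split (T a) w.
Proof. by case/left_split_image => y yE; rewrite !yE lam_tens. Qed.

Lemma lamP k z z' : lam T (k *: z + z') = k *: lam T z + lam T z'.
Proof.
(* The inverse of a linear bijection is linear. *)
have VinvP : Viso_inv j (k *: z + z') = k *: Viso_inv j z + Viso_inv j z'.
  by apply: (can_inj (@VisoK _ _ _ X j)); rewrite VisoP !Viso_invK.
rewrite /lam VinvP /tens_map tensor_liftP ?VisoP //.
- by move=> *; rewrite linearP tensPl.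
- by move=> *; rewrite tensPr.
- by move=> *; rewrite Tb tens_bal.
Qed.
End LeftOperator.

Section RightOperator.
Variable T : {linear addB (X j) -> addB (X j)}.
Hypothesis Tb : forall b x, T (lact b x) = lact b (T x).

Lemma rho_right_split a w : ~~ ends j w -> rho T (right_split a w) = right_split (T a) w.
Proof. by case/right_split_image => y yE; rewrite !yE rho_tens. Qed.

Lemma rhoP k z z' : rho T (k *: z + z') = k *: rho T z + rho T z'.
Proof.
have WinvP : Wiso_inv j (k *: z + z') = k *: Wiso_inv j z + Wiso_inv j z'.
  by apply: (can_inj (@WisoK _ _ _ X j)); rewrite WisoP !Wiso_invK.
rewrite /rho WinvP /tens_map tensor_liftP ?WisoP //.
- by move=> *; rewrite tensPl.
- by move=> *; rewrite linearP tensPr.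
- by move=> *; rewrite Tb tens_bal.
Qed.
End RightOperator.

End Action.

End FreeProductAction.
Arguments vec {K B I X} w.

(** * The coaction *)

Section Coaction.
Variables (K : fieldType) (B : algType K) (I : finType) (X : I -> bimodule B).
Variables (Q : algType K) (u : I -> I -> Q).
Hypothesis u_sum : forall j, \sum_i u i j = 1.
Hypothesis u_col : forall i i' j, u i j * u i' j = if i == i' then u i j else 0.
Hypothesis u_row : forall i j j', j != j' -> u i j * u i j' = 0.

Local Notation letter := {i : I & X i}.
Local Notation FP := (free_prod X).

Variable coherent : (forall i, addB (X i)) -> Prop.
Hypothesis coh_vac : coherent (fun i => (1, 0)).
Hypothesis cohP : forall k v v',
  coherent v -> coherent v' -> coherent (fun i => k *: v i + v' i).
Hypothesis coh_lact : forall b v, coherent v -> coherent (fun i => lact b (v i)).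
Hypothesis coh_ract : forall b v, coherent v -> coherent (fun i => ract (v i) b).
Hypothesis coh_fst : forall v i i', coherent v -> (v i).1 = (v i').1.

Local Notation family := (forall i, X i).
Implicit Types (s : seq (I * family)) (f g : FP -> K) (w : seq letter).

(** Each letter carries a whole family of vectors, because the coaction replaces its index by every
    other one and needs the corresponding vector there. *)
Definition wd s : seq letter := [seq ltr (p.2 p.1) | p <- s].

Definition coherent0 (y : family) : Prop := coherent (fun i => (0, y i)).

Definition good s : Prop :=
  sorted (fun i j => i != j) (map tag (wd s)) /\
  foldr (fun p P => coherent0 p.2 /\ P) True s.

Lemma wd_rcons s p : wd (rcons s p) = rcons (wd s) (ltr (p.2 p.1)).
Proof. exact: map_rcons. Qed.

Lemma ends_rcons i w l : ends i (rcons w l) = (tag l == i).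
Proof. by case: w => //= l' w; rewrite last_rcons. Qed.

Lemma good_cons j (y : family) s :
  good ((j, y) :: s) <-> [/\ coherent0 y, good s & ~~ starts j (wd s)].
Proof.
split=> [[/= h [cy cs]]|[cy [h cs] ne]].
  split=> //; first by split=> //; case: (s) h => //= p s' /andP[].
  by case: (s) h => //= p s' /andP[]; rewrite eq_sym.
split=> //=; case: (s) h ne => //= p s' -> ne.
by rewrite andbT eq_sym.
Qed.

Lemma good_rcons j (y : family) s :
  good (rcons s (j, y)) <-> [/\ coherent0 y, good s & ~~ ends j (wd s)].
Proof.
have coh_rcons : foldr (fun p P => coherent0 p.2 /\ P) True (rcons s (j, y)) <->
    coherent0 y /\ foldr (fun p P => coherent0 p.2 /\ P) True s.
  by elim: s => [|p s IH] /=; [tauto|rewrite IH; tauto].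
have sorted_rcons : sorted (fun i j => i != j) (map tag (wd (rcons s (j, y)))) =
    sorted (fun i j => i != j) (map tag (wd s)) && ~~ ends j (wd s).
  by rewrite wd_rcons map_rcons; case: (wd s) => //= l w; rewrite rcons_path last_map.
rewrite /good coh_rcons sorted_rcons; split=> [[/andP[-> ->] []]|[cy [-> cs] ->]] //.
Qed.

(* [spread s (f \o vec)] is the image under [f (x) id] of the coaction on the
   elementary tensor [vec (wd s)]. *)
Fixpoint spread s (g : seq letter -> K) : Q :=
  if s is (j, y) :: s' then \sum_i u i j * spread s' (fun w => g (ltr (y i) :: w))
  else g [::] *: 1.

Lemma eq_spread s (g g' : seq letter -> K) : g =1 g' -> spread s g = spread s g'.
Proof. by move/funext->. Qed.

Lemma spreadD s (g g' : seq letter -> K) :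
  spread s (fun w => g w + g' w) = spread s g + spread s g'.
Proof.
elim: s g g' => [|[j y] s IH] g g' /=; first by rewrite scalerDl.
by rewrite -big_split; apply: eq_bigr => i _; rewrite IH mulrDr.
Qed.

Lemma spread0 s : spread s (fun=> 0) = 0.
Proof.
elim: s => [|[j y] s IH] /=; first by rewrite scale0r.
by rewrite big1 // => i _; rewrite IH mulr0.
Qed.

(** [spread] recurses on the first letter; this recursion on the last one serves the right
    operators. *)
Lemma spread_rcons s j (y : family) (g : seq letter -> K) :
  spread (rcons s (j, y)) g =
  \sum_i spread s (fun w => g (rcons w (ltr (y i)))) * u i j.
Proof.
elim: s g => [|[j' y'] s IH] g /=.
  by apply: eq_bigr => i _; rewrite -scalerAr -scalerAl mulr1 mul1r.
under eq_bigr do rewrite IH mulr_sumr.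
rewrite exchange_big; apply: eq_bigr => i _; rewrite mulr_suml.
by apply: eq_bigr => i' _; rewrite mulrA.
Qed.

(** A word starting with [i] comes with a factor [u i j * u i j'] where [j' != j], which is zero by
    row orthogonality. So [g] matters only on words to which a letter of index [i] may be
    prepended. *)
Lemma spread_starts s i j (g g' : seq letter -> K) : ~~ starts j (wd s) ->
  (forall w, ~~ starts i w -> g w = g' w) ->
  u i j * spread s g = u i j * spread s g'.
Proof.
case: s => [_|[j' y] s /= ne] gg' /=; first by rewrite gg'.
rewrite !mulr_sumr; apply: eq_bigr => i' _; rewrite !mulrA.
have [<-|ne'] := eqVneq i i'; first by rewrite u_row ?mul0r // eq_sym.
by congr (_ * _); apply: eq_spread => w; rewrite gg' //= eq_sym.
Qed.

Lemma spread_ends s i j (g g' : seq letter -> K) : ~~ ends j (wd s) ->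
  (forall w, ~~ ends i w -> g w = g' w) ->
  spread s g * u i j = spread s g' * u i j.
Proof.
case/lastP: s => [_|s [j' y]] gg' /=; first by rewrite gg'.
rewrite wd_rcons ends_rcons /= in gg' * => ne.
rewrite !spread_rcons !mulr_suml; apply: eq_bigr => i' _; rewrite -!mulrA.
have [<-|ne'] := eqVneq i i'; first by rewrite u_row ?mulr0.
by congr (_ * _); apply: eq_spread => w; rewrite ne // ends_rcons /= eq_sym.
Qed.

Definition is_linear f := forall k x y, f (k *: x + y) = k * f x + f y.

(* [theta f] is the image under [f (x) id] of the coaction applied to [xi]. *)
Inductive coact : FP -> ((FP -> K) -> Q) -> Prop :=
| coact_vac b : coact (lact b (vec [::])) (fun f => f (lact b (vec [::])) *: 1)
| coact_word s : good s -> coact (vec (wd s)) (fun f => spread s (f \o vec))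
| coact_lin k xi theta xi' theta' : coact xi theta -> coact xi' theta' ->
    coact (k *: xi + xi') (fun f => k *: theta f + theta' f)
| coact_ext xi theta theta' : coact xi theta ->
    (forall f, is_linear f -> theta f = theta' f) -> coact xi theta'.

Lemma is_linearD f x y : is_linear f -> f (x + y) = f x + f y.
Proof. by move=> fP; have := fP 1 x y; rewrite scale1r mul1r. Qed.

Lemma coactD xi theta xi' theta' : coact xi theta -> coact xi' theta' ->
  coact (xi + xi') (fun f => theta f + theta' f).
Proof.
move=> c c'; rewrite -[xi]scale1r; apply: coact_ext (coact_lin 1 c c') _ => f _.
by rewrite scale1r.
Qed.

(** Invariance of the vacuum expectation: the vectors [lact b (vec [::])] are fixed, and nonempty
    words stay nonempty, hence have first component 0. *)
Lemma coact_expect xi theta (psi : B -> K) : coact xi theta ->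
  (forall k a b, psi (k *: a + b) = k * psi a + psi b) ->
  theta (fun z => psi z.1) = psi xi.1 *: 1.
Proof.
move=> c psiP; have psi0 : psi 0 = 0.
  by have := psiP (-1) 0 0; rewrite scaler0 addr0 mulN1r addNr.
elim: c => {xi theta} [b|[|[i y] s] _|k xi theta xi' theta' _ IH _ IH'|xi theta theta' _ IH e].
- by [].
- by [].
- rewrite /= psi0 scale0r big1 // => i' _.
  by rewrite spread0 mulr0.
- by rewrite IH IH' psiP scalerDl scalerA.
- by rewrite -e // => k x y; rewrite psiP.
Qed.

Lemma coact_lact b s : good s ->
  coact (lact b (vec (wd s))) (fun f => spread s (fun w => f (lact b (vec w)))).
Proof.
case: s => [|[i y] s] gs; first exact: coact_vac.
rewrite [wd _]/= lact_vec.
have gs' : good ((i, fun i => lact b (y i)) :: s).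
  move/good_cons: gs => [cy gs ne]; apply/good_cons; split=> //.
  have := coh_lact b cy; congr coherent.
  by apply: functional_extensionality_dep => i'; rewrite lact_inr.
apply: coact_ext (coact_word gs') _ => f _ /=.
apply: eq_bigr => i' _; congr (_ * _); apply: eq_spread => w.
by apply: (congr1 f); exact/esym/lact_vec.
Qed.

Lemma coact_ract b s : good s ->
  coact (ract (vec (wd s)) b) (fun f => spread s (fun w => f (ract (vec w) b))).
Proof.
case/lastP: s => [|s [i y]] gs.
  by have := coact_vac b; rewrite lact_vac -ract_vac.
rewrite wd_rcons [ltr _]/= ract_vec.
have gs' : good (rcons s (i, fun i => ract (y i) b)).
  move/good_rcons: gs => [cy gs ne]; apply/good_rcons; split=> //.
  have := coh_ract b cy; congr coherent.
  by apply: functional_extensionality_dep => i'; rewrite ract_inr.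
have := coact_word gs'; rewrite wd_rcons => c.
apply: coact_ext c _ => f _; rewrite !spread_rcons.
apply: eq_bigr => i' _; congr (_ * _); apply: eq_spread => w.
by apply: (congr1 f); exact/esym/ract_vec.
Qed.

Lemma coh_scalar b : coherent (fun i => (b, 0)).
Proof.
have := coh_lact b coh_vac; congr coherent; apply: functional_extensionality_dep => i.
by apply: pair_ext; rewrite /= ?mulr1 ?lact0.
Qed.

(** The components in [B] agree for all [i], so subtracting one multiple of the vacuum family
    removes them all. *)
Lemma coherent_snd (a : forall i, addB (X i)) (j : I) :
  coherent a -> coherent0 (fun i => (a i).2).
Proof.
move=> ca; have := cohP (-1) (coh_lact (a j).1 coh_vac) ca.
congr coherent; apply: functional_extensionality_dep => i.
apply: pair_ext; rewrite /= scaleN1r.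
  by rewrite mulr1 (coh_fst j i ca) addNr.
by rewrite lact0 oppr0 add0r.
Qed.

(** The coaction puts a factor [u i j] only on the part with the new letter. Inserting
    [1 = \sum_i u i j] gives the part in [B] the same shape, its coefficient being common to all
    [i]. *)
Lemma coact_left_split j (a : forall i, addB (X i)) s :
  coherent a -> good s -> ~~ starts j (wd s) ->
  coact (left_split (a j) (wd s))
        (fun f => \sum_i u i j * spread s (fun w => f (left_split (a i) w))).
Proof.
move=> ca gs ne.
have gs' : good ((j, fun i => (a i).2) :: s).
  by apply/good_cons; split=> //; apply: coherent_snd j ca.
apply: coact_ext (coactD (coact_lact (a j).1 gs) (coact_word gs')) _ => f fP /=.
rewrite -[X in X + _]mul1r -(u_sum j) mulr_suml -big_split; apply: eq_bigr => i _ /=.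
rewrite -mulrDr -spreadD; congr (_ * _); apply: eq_spread => w.
by rewrite -is_linearD // /left_split (coh_fst j i ca).
Qed.

Lemma coact_right_split j (a : forall i, addB (X i)) s :
  coherent a -> good s -> ~~ ends j (wd s) ->
  coact (right_split (a j) (wd s))
        (fun f => \sum_i spread s (fun w => f (right_split (a i) w)) * u i j).
Proof.
move=> ca gs ne.
have gs' : good (rcons s (j, fun i => (a i).2)).
  by apply/good_rcons; split=> //; apply: coherent_snd j ca.
have := coact_word gs'; rewrite wd_rcons => c.
apply: coact_ext (coactD (coact_ract (a j).1 gs) c) _ => f fP /=.
rewrite spread_rcons -[X in X + _]mulr1 -(u_sum j) mulr_sumr -big_split.
apply: eq_bigr => i _ /=.
rewrite -mulrDl -spreadD; congr (_ * _); apply: eq_spread => w.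
by rewrite -is_linearD // /right_split (coh_fst j i ca).
Qed.

(** * Compatibility of the coaction with left and right operators *)

Section Operators.
Variable T : forall i, {linear addB (X i) -> addB (X i)}.
Hypothesis T_coh : forall a : (forall i, addB (X i)), coherent a -> coherent (fun i => T i (a i)).

Lemma coact_lam j xi theta :
  (forall i v b, T i (ract v b) = ract (T i v) b) -> coact xi theta ->
  coact (lam (T j) xi) (fun f => \sum_i u i j * theta (f \o lam (T i))).
Proof.
move=> Tb; have lin_lam f i : is_linear f -> is_linear (f \o lam (T i)).
  by move=> fP k x y /=; rewrite lamP // fP.
(* The claim for any vector presented as a split at the index [j]; each generator of [coact] is such
   a split. *)
have split_case (a : forall i, addB (X i)) s xi' theta' :
    coherent a -> good s -> ~~ starts j (wd s) ->
    xi' = left_split (a j) (wd s) ->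
    (forall f, is_linear f ->
       theta' f = \sum_i u i j * spread s (fun w => f (left_split (a i) w))) ->
    coact (lam (T j) xi') (fun f => \sum_i u i j * theta' (f \o lam (T i))).
  move=> ca gs ne -> thetaE; rewrite lam_left_split //.
  apply: coact_ext (coact_left_split (T_coh ca) gs ne) _ => f fP.
  apply: eq_bigr => i _; rewrite thetaE; last exact: lin_lam.
  (* Column orthogonality kills the terms in which the operator at [i] would meet a split at another
     index. *)
  rewrite (bigD1 i) //= mulrDr mulr_sumr big1 => [|i' ne']; last first.
    by rewrite eq_sym in ne'; rewrite mulrA u_col (negbTE ne') mul0r.
  rewrite addr0 mulrA u_col eqxx; apply: spread_starts => // w nw /=.
  by rewrite lam_left_split.
elim=> {xi theta} [b|s gs|k xi theta xi' theta' _ IH _ IH'|xi theta theta' _ IH e].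
- apply: (split_case (fun i => (b, 0) : addB (X i)) [::] _
    (fun f => f (lact b (vec [::])) *: 1)) => //; first exact: coh_scalar.
    by rewrite left_split_fst.
  move=> f fP; rewrite -[LHS]mul1r -[X in X * _](u_sum j) mulr_suml.
  by apply: eq_bigr => i _; rewrite [spread _ _]/= left_split_fst.
(* A word not starting with [j] is split off from the unit [(1, 0)]; otherwise its first letter is
   the split factor. *)
- have [st|ne] := boolP (starts j (wd s)); last first.
    apply: (split_case (fun i => (1, 0) : addB (X i)) s _
      (fun f => spread s (f \o vec))) => //.
      by rewrite left_split_fst lact1.
    move=> f fP; rewrite -[LHS]mul1r -[X in X * _](u_sum j) mulr_suml.
    apply: eq_bigr => i _; congr (_ * _); apply: eq_spread => w.
    by rewrite left_split_fst lact1.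
  case: s gs st => [//|[i y] s] /good_cons[cy gs ne] /= /eqP ij; subst i.
  apply: (split_case (fun i => (0, y i) : addB (X i)) s _
    (fun f => spread ((j, y) :: s) (f \o vec))) => //.
    by rewrite left_split_snd.
  move=> f fP; apply: eq_bigr => i _; congr (_ * _); apply: eq_spread => w.
  by rewrite left_split_snd.
- rewrite lamP //; apply: coact_ext (coact_lin k IH IH') _ => f _.
  rewrite scaler_sumr -big_split; apply: eq_bigr => i _ /=.
  by rewrite mulrDr scalerAr.
- apply: coact_ext IH _ => f fP; apply: eq_bigr => i _.
  by rewrite e //; apply: lin_lam.
Qed.

Lemma coact_rho j xi theta :
  (forall i b v, T i (lact b v) = lact b (T i v)) -> coact xi theta ->
  coact (rho (T j) xi) (fun f => \sum_i theta (f \o rho (T i)) * u i j).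
Proof.
move=> Tb; have lin_rho f i : is_linear f -> is_linear (f \o rho (T i)).
  by move=> fP k x y /=; rewrite rhoP // fP.
have split_case (a : forall i, addB (X i)) s xi' theta' :
    coherent a -> good s -> ~~ ends j (wd s) ->
    xi' = right_split (a j) (wd s) ->
    (forall f, is_linear f ->
       theta' f = \sum_i spread s (fun w => f (right_split (a i) w)) * u i j) ->
    coact (rho (T j) xi') (fun f => \sum_i theta' (f \o rho (T i)) * u i j).
  move=> ca gs ne -> thetaE; rewrite rho_right_split //.
  apply: coact_ext (coact_right_split (T_coh ca) gs ne) _ => f fP.
  apply: eq_bigr => i _; rewrite thetaE; last exact: lin_rho.
  rewrite (bigD1 i) //= mulrDl mulr_suml big1 => [|i' ne']; last first.
    by rewrite -mulrA u_col (negbTE ne') mulr0.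
  rewrite addr0 -mulrA u_col eqxx; apply: spread_ends => // w nw /=.
  by rewrite rho_right_split.
elim=> {xi theta} [b|s gs|k xi theta xi' theta' _ IH _ IH'|xi theta theta' _ IH e].
- apply: (split_case (fun i => (b, 0) : addB (X i)) [::] _
    (fun f => f (lact b (vec [::])) *: 1)) => //; first exact: coh_scalar.
    by rewrite right_split_fst ract_vac lact_vac.
  move=> f fP; rewrite -[LHS]mulr1 -[X in _ * X](u_sum j) mulr_sumr.
  by apply: eq_bigr => i _; rewrite [spread _ _]/= right_split_fst ract_vac lact_vac.
- have [st|ne] := boolP (ends j (wd s)); last first.
    apply: (split_case (fun i => (1, 0) : addB (X i)) s _
      (fun f => spread s (f \o vec))) => //.
      by rewrite right_split_fst ract1.
    move=> f fP; rewrite -[LHS]mulr1 -[X in _ * X](u_sum j) mulr_sumr.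
    apply: eq_bigr => i _; congr (_ * _); apply: eq_spread => w.
    by rewrite right_split_fst ract1.
  case/lastP: s gs st => [//|s [i y]] /good_rcons[cy gs ne].
  rewrite wd_rcons ends_rcons /= => /eqP ij; subst i.
  apply: (split_case (fun i => (0, y i) : addB (X i)) s _
    (fun f => spread (rcons s (j, y)) (f \o vec))) => //.
    by rewrite right_split_snd.
  move=> f fP; rewrite spread_rcons.
  apply: eq_bigr => i _; congr (_ * _); apply: eq_spread => w.
  by rewrite right_split_snd.
- rewrite rhoP //; apply: coact_ext (coact_lin k IH IH') _ => f _.
  rewrite scaler_sumr -big_split; apply: eq_bigr => i _ /=.
  by rewrite mulrDl scalerAl.
- apply: coact_ext IH _ => f fP; apply: eq_bigr => i _.
  by rewrite e //; apply: lin_rho.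
Qed.

End Operators.
End Coaction.

(** * Moments *)

Section SChiOrder.

Lemma s_chi_prod (Q : pzSemiRingType) n (chi : 'I_n -> side) (F : 'I_n -> Q) :
  \prod_(t < n) F (s_chi chi t) = \prod_(k <- chi_order chi) F k.
Proof.
have sz : size (chi_order chi) = n.
  rewrite size_cat size_rev !size_filter.
  exact: etrans (count_predC (fun k => Defs.is_left (chi k)) _) (size_enum_ord n).
suff -> : chi_order chi = [seq s_chi chi t | t <- enum 'I_n].
  by rewrite big_map enumT [index_enum _]unlock.
case: n chi F sz => [|n] chi F sz.
  by rewrite (size0nil sz) enum_ord0.
apply: (@eq_from_nth _ ord0) => [|k]; first by rewrite sz size_map size_enum_ord.
rewrite sz => kn.
rewrite (nth_map ord0) ?size_enum_ord // permE /s_fun.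
rewrite (set_nth_default ord0) ?sz ?ltn_ord //; congr nth.
by rewrite nth_enum_ord.
Qed.

(** Position 0 is the least, so it comes first among the left positions and, after reversal, last
    among the right ones. *)
Lemma chi_orderS n (chi : 'I_n.+1 -> side) :
  chi_order chi =
  let s := [seq lift ord0 k | k <- chi_order (fun k => chi (lift ord0 k))] in
  if chi ord0 is Left then ord0 :: s else rcons s ord0.
Proof.
rewrite /chi_order enum_ordSl /= !filter_map map_cat map_rev /preim /=.
by case: (chi ord0) => //=; rewrite rev_cons rcons_cat.
Qed.

Definition ffcons (T : Type) n (i : T) (J : 'I_n -> T) : {ffun 'I_n.+1 -> T} :=
  [ffun k => if unlift ord0 k is Some k' then J k' else i].

Lemma ffcons0 (T : Type) n (i : T) (J : 'I_n -> T) : ffcons i J ord0 = i.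
Proof. by rewrite ffunE unlift_none. Qed.

Lemma ffconsS (T : Type) n (i : T) (J : 'I_n -> T) k : ffcons i J (lift ord0 k) = J k.
Proof. by rewrite ffunE liftK. Qed.

Lemma sum_ffcons (V : nmodType) (T : finType) n (F : {ffun 'I_n.+1 -> T} -> V) :
  \sum_J F J = \sum_i \sum_(J : {ffun 'I_n -> T}) F (ffcons i J).
Proof.
rewrite pair_bigA /= (reindex (fun p : T * {ffun 'I_n -> T} => ffcons p.1 p.2)) //.
exists (fun J : {ffun 'I_n.+1 -> T} => (J ord0, [ffun k => J (lift ord0 k)])) => [[i J]|J] _ /=.
  by rewrite ffcons0; congr pair; apply/ffunP => k; rewrite ffunE ffconsS.
apply/ffunP => k; case: (unliftP ord0 k) => [k'|] ->; first by rewrite ffconsS ffunE.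
by rewrite ffcons0.
Qed.

Lemma u_chi_ffcons (Q : pzSemiRingType) N n (u : 'I_N -> 'I_N -> Q)
    (chi : 'I_n.+1 -> side) i (I : 'I_n -> 'I_N) J :
  let w := u_chi u (fun k => chi (lift ord0 k)) I (fun k => J (lift ord0 k)) in
  u_chi u chi (ffcons i I) J =
  if chi ord0 is Left then u i (J ord0) * w else w * u i (J ord0).
Proof.
move=> w; have -> : w = \prod_(k <- chi_order (fun k : 'I_n => chi (lift ord0 k)))
    u (I k) (J (lift ord0 k)).
  exact: (s_chi_prod _ (fun k => u (I k) (J (lift ord0 k)))).
rewrite [LHS](s_chi_prod chi (fun k => u (ffcons i I k) (J k))) chi_orderS.
case: (chi ord0) => /=; rewrite ?big_cons ?big_rcons /= big_map ffcons0;
  by congr (_ * _); apply: eq_bigr => k _; rewrite ffconsS.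
Qed.

End SChiOrder.

(** * Equality of arbitrary one-index moments with coefficients from [B] *)

Section Distribution.
Variables (K : fieldType) (A B : algType K) (P : BBncps A B) (I : Type).
Variable x : I -> side -> A.
Hypothesis x_pair : forall j, is_Bpair P (x j).
Hypothesis x_id : identically_distributed P x.

Definition letter_val j (t : side * option B) : A :=
  if t.2 is Some b then opT P t.1 b else x j t.1.

(* As [L_b] commutes with [R_c] and [x^r], and [R_b] with [x^l], each [L] can be
   moved to the right until it meets an [x^l], and each [R] until it meets an
   [x^r]. *)
Definition normal_form j (s : seq (side * B)) (c d : B) : A :=
  \prod_(p <- s) (opT P p.1 p.2 * x j p.1) * eps P c d.

Lemma opT_eps t e c d : exists c' d', opT P t e * eps P c d = eps P c' d'.
Proof. by case: t; rewrite epsM; do 2!eexists. Qed.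

Lemma opT_opT t e b : exists b', opT P t e * opT P t b = opT P t b'.
Proof.
case: t; rewrite /= /opL /opR epsM mul1r; first by exists (e * b).
by exists (b * e).
Qed.

Lemma opT_opposite t t' e b : Defs.is_left t != Defs.is_left t' ->
  opT P t e * opT P t' b = opT P t' b * opT P t e.
Proof. by case: t t' => [] [] // _; rewrite /= /opL /opR !epsM !mulr1 !mul1r. Qed.

Lemma opT_x j t t' e : Defs.is_left t != Defs.is_left t' ->
  opT P t e * x j t' = x j t' * opT P t e.
Proof. by have [xl xr] := x_pair j; case: t t' => [] [] // _; rewrite /= ?xl ?xr. Qed.

(** The order of quantifiers matters: one normal form serves every [j]. *)
Lemma opT_normal_form t e s c d : exists s' c' d',
  forall j, opT P t e * normal_form j s c d = normal_form j s' c' d'.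
Proof.
elim: s => [|[t' b] s [s' [c' [d' IH]]]].
  have [c' [d' cd]] := opT_eps t e c d; exists [::], c', d' => j.
  by rewrite /normal_form big_nil !mul1r.
have [tt'|tt'] := eqVneq (Defs.is_left t) (Defs.is_left t').
  have {tt'} -> : t = t' by case: t t' tt' {IH} => [] [].
  have [b' bb'] := opT_opT t' e b; exists ((t', b') :: s), c, d => j.
  by rewrite /normal_form !big_cons /= -bb' !mulrA.
exists ((t', b) :: s'), c', d' => j; rewrite /normal_form !big_cons /= -[RHS]mulrA.
rewrite -/(normal_form j s' c' d') -IH !mulrA opT_opposite //.
by rewrite -[_ * x j t']mulrA opT_x // !mulrA.
Qed.

Lemma word_normal_form w : exists s c d,
  forall j, \prod_(t <- w) letter_val j t = normal_form j s c d.
Proof.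
elim: w => [|[t o] w [s [c [d IH]]]].
  by exists [::], 1, 1 => j; rewrite /normal_form !big_nil eps1 mulr1.
case: o => [b|].
  have [s' [c' [d' E]]] := opT_normal_form t b s c d.
  by exists s', c', d' => j; rewrite big_cons IH E.
exists ((t, 1) :: s), c, d => j; rewrite big_cons IH /normal_form big_cons /=.
by case: t; rewrite /= /opL /opR eps1 mul1r mulrA.
Qed.

Lemma expect_word w j j' :
  expect P (\prod_(t <- w) letter_val j t) = expect P (\prod_(t <- w) letter_val j' t).
Proof.
have [s [c [d E]]] := word_normal_form w; rewrite !{}E.
pose p0 : side * B := (Left, 0).
(* A [Bmoment] ends in a single [L] or [R]: under [expect], the trailing [R_d] may be replaced by
   [L_d], which merges with [L_c] into [L_(c d)]. *)
pose s' := rcons s (Left, c * d).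
suff E i : expect P (normal_form i s c d) =
    Bmoment P (x i) (fun k : 'I_(size s) => (nth p0 s k).1)
      (fun k => (nth p0 s' k).1) (fun k => (nth p0 s' k).2).
  by rewrite !E; exact: x_id.
have -> : normal_form i s c d =
    \prod_(p <- s) (opT P p.1 p.2 * x i p.1) * eps P c 1 * eps P 1 d.
  by rewrite -mulrA epsM mulr1 mulr1.
rewrite -expect_LR -mulrA epsM mulr1 /Bmoment.
rewrite (big_nth p0) big_mkord; congr (expect P (_ * _)).
  by apply: eq_bigr => k _; rewrite /= nth_rcons ltn_ord.
by rewrite /= nth_rcons ltnn eqxx.
Qed.

End Distribution.

(** * Corresponding vectors in the representation spaces *)

Section Model.
Variables (K : fieldType) (A B : algType K) (P : BBncps A B) (I : choiceType).
Variable x : I -> side -> A.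
Hypothesis x_pair : forall j, is_Bpair P (x j).
Hypothesis x_id : identically_distributed P x.
Variables (X : I -> bimodule B).
Variables (l r : forall j, A -> {linear addB (X j) -> addB (X j)}).
Local Notation C j := (gen_faces P (x j)).
Hypothesis l_rep : forall j, left_rep P (C j Left) (@l j).
Hypothesis r_rep : forall j, right_rep P (C j Right) (@r j).

Definition face_op j (s : side) (a : A) : free_prod X -> free_prod X :=
  if s is Left then lam (l j a) else rho (r j a).

Hypothesis joint : forall n (j : 'I_n -> I) (s : 'I_n -> side) (a : 'I_n -> A),
  (forall k, C (j k) (s k) (a k)) ->
  expect P (\prod_(k < n) a k) =
  vac_expect (\big[(fun S T => S \o T)/id]_(k < n) face_op (j k) (s k) (a k)).

Definition local_op j (s : side) (a : A) : {linear addB (X j) -> addB (X j)} :=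
  if s is Left then l j a else r j a.

Lemma gen_face_x j s : C j s (x j s).
Proof. by move=> U [_]; apply; left. Qed.

Lemma gen_face_letter j t : C j t.1 (letter_val P x j t).
Proof.
case: t => s [b|] /=; last exact: gen_face_x.
by move=> U [_]; apply; right; exists b.
Qed.

(** Next to the empty word, left and right splits coincide. They embed [addB (X j)] in the free
    product compatibly with both faces, which reduces the moments of one pair to its own space. *)
Lemma face_op_left_split j s a (v : addB (X j)) : C j s a ->
  face_op j s a (left_split v [::]) = left_split (local_op j s a v) [::].
Proof.
have leftright (w : addB (X j)) : left_split w [::] = right_split w [::].
  by rewrite /left_split /right_split lact_vac ract_vac.
case: s => Ca /=.
  have [lb _ _ _] := l_rep j.
  by rewrite lam_left_split // => v' b; rewrite lb.
have [rb _ _ _] := r_rep j.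
by rewrite !leftright rho_right_split // => b v'; rewrite rb.
Qed.

Definition word_vec j (w : seq (side * option B)) : addB (X j) :=
  foldr (fun t v => local_op j t.1 (letter_val P x j t) v) (1, 0) w.

Lemma word_vec_fst j w : (word_vec j w).1 = expect P (\prod_(t <- w) letter_val P x j t).
Proof.
pose t0 : side * option B := (Left, None).
rewrite (big_nth t0) big_mkord (joint (j := fun=> j) (s := fun k => (nth t0 w k).1)); last first.
  by move=> k; exact: gen_face_letter.
rewrite -(big_mkord xpredT (fun k => face_op j (nth t0 w k).1 (letter_val P x j (nth t0 w k)))).
rewrite -(big_nth t0 xpredT (fun t => face_op j t.1 (letter_val P x j t))).
rewrite /vac_expect; suff -> : (\big[(fun S T => S \o T)/id]_(t <- w)
    face_op j t.1 (letter_val P x j t)) (1, 0) = left_split (word_vec j w) [::].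
  by rewrite /left_split /= mulr1 addr0.
elim: w => [|t w IH]; first by rewrite big_nil left_split_fst lact1.
by rewrite big_cons /= IH face_op_left_split //; exact: gen_face_letter.
Qed.

(* Vectors of the [X j] which correspond to each other; they replace the common
   model that would exist if the [X j] were all equal. *)
Inductive coherent : (forall j, addB (X j)) -> Prop :=
| coherent_word w : coherent (fun j => word_vec j w)
| coherent_lin k v v' : coherent v -> coherent v' ->
    coherent (fun j => k *: v j + v' j).

(** First components are moments, so this is where the identical distribution enters. *)
Lemma coherent_fst v i j : coherent v -> (v i).1 = (v j).1.
Proof.
elim=> {v} [w|k v v' _ IH _ IH'].
  by rewrite !word_vec_fst; exact: expect_word.
by rewrite /= IH IH'.
Qed.

Lemma coherent_letter t v : coherent v ->
  coherent (fun j => local_op j t.1 (letter_val P x j t) (v j)).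
Proof.
elim=> {v} [w|k v v' _ IH _ IH']; first exact: (coherent_word (t :: w)).
rewrite (_ : (fun _ => _) = (fun j => k *: local_op j t.1 (letter_val P x j t) (v j)
    + local_op j t.1 (letter_val P x j t) (v' j))); first exact: coherent_lin.
by apply: functional_extensionality_dep => j; rewrite linearP.
Qed.

(** The left action of [b] is the operator of the letter [L_b]. *)
Lemma coherent_lact b v : coherent v -> coherent (fun j => lact b (v j)).
Proof.
move/(coherent_letter (Left, Some b)); congr coherent.
by apply: functional_extensionality_dep => j /=; have [_ _ _ ->] := l_rep j.
Qed.

Lemma coherent_ract b v : coherent v -> coherent (fun j => ract (v j) b).
Proof.
move/(coherent_letter (Right, Some b)); congr coherent.
by apply: functional_extensionality_dep => j /=; have [_ _ _ ->] := r_rep j.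
Qed.

End Model.

(** The algebraic core, over any field: the quantum permutations enter through the relations on [u],
    the state through a linear functional on [B]. *)
Lemma quantum_invariance (K : fieldType) (A B : algType K) (P : BBncps A B) N
    (x : 'I_N -> side -> A) (Q : algType K) (u : 'I_N -> 'I_N -> Q) :
  (forall j, is_Bpair P (x j)) -> bifree P x -> identically_distributed P x ->
  (forall j, \sum_i u i j = 1) ->
  (forall i i' j, u i j * u i' j = if i == i' then u i j else 0) ->
  (forall i j j', j != j' -> u i j * u i j' = 0) ->
  forall psi : B -> K, (forall k b b', psi (k *: b + b') = k * psi b + psi b') ->
  forall n (chi : 'I_n -> side) (J : 'I_n -> 'I_N),
  psi (expect P (\prod_(k < n) x (J k) (chi k))) *: (1 : Q) =
  \sum_(I : {ffun 'I_n -> 'I_N})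
    psi (expect P (\prod_(k < n) x (I k) (chi k))) *: u_chi u chi I J.
Proof.
move=> x_pair [_ [X [l [r [l_rep r_rep joint]]]]] x_id u_sum u_col u_row psi psiP n chi J.
pose coh := @coherent _ _ _ P _ x X l r.
have coh_fst v i i' : coh v -> (v i).1 = (v i').1 by exact: coherent_fst.
pose op i s : free_prod X -> free_prod X := face_op l r i s (x i s).
pose T n (J : 'I_n -> 'I_N) chi : free_prod X -> free_prod X :=
  \big[(fun S T => S \o T)/id]_(k < n) op (J k) (chi k).
(* The first factor is applied last, so the induction peels it off: a left one multiplies by its [u]
   on the left, a right one on the right, matching [u_chi_ffcons]. *)
have coactT n' chi' J' : coact u coh (T n' J' chi' (1, 0))
    (fun f => \sum_(I : {ffun 'I_n' -> 'I_N}) f (T n' I chi' (1, 0)) *: u_chi u chi' I J').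
  elim: n' chi' J' => [|n' IH] chi' J'.
    rewrite /T big_ord0; have := coact_vac u coh 1; rewrite lact1 => c.
    apply: coact_ext c _ => f _.
    under eq_bigr do rewrite big_ord0 /u_chi big_ord0.
    by rewrite sumr_const card_ffun !card_ord expn0.
  have {IH} := IH (fun k => chi' (lift ord0 k)) (fun k => J' (lift ord0 k)).
  set xi := T n' _ _ _; set theta := (fun f => _) => c.
  have -> : T n'.+1 J' chi' (1, 0) = op (J' ord0) (chi' ord0) xi.
    by rewrite /T big_ord_recl.
  have consE i (I : {ffun 'I_n' -> 'I_N}) : T n'.+1 (ffcons i I) chi' (1, 0) =
      op i (chi' ord0) (T n' I (fun k => chi' (lift ord0 k)) (1, 0)).
    rewrite /T big_ord_recl; under eq_bigr do rewrite ffconsS.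
    by rewrite ffcons0.
  have stable s v : coh v -> coh (fun i => local_op l r i s (x i s) (v i)).
    exact: (@coherent_letter _ _ _ P _ x X l r (s, None)).
  have Ci i s : gen_faces P (x i) s (x i s) by exact: gen_face_x.
  have coh_vac : coh (fun i => (1, 0)) by exact: (coherent_word _ _ _ _ [::]).
  have cohP k v v' : coh v -> coh v' -> coh (fun i => k *: v i + v' i).
    exact: coherent_lin.
  have coh_l b v : coh v -> coh (fun i => lact b (v i)) by exact: coherent_lact.
  have coh_r b v : coh v -> coh (fun i => ract (v i) b) by exact: coherent_ract.
  rewrite /op; case chi0 : (chi' ord0) => /=.
    have Tb i v b : l i (x i Left) (ract v b) = ract (l i (x i Left) v) b.
      by have [-> //] := l_rep i; exact: Ci.
    apply: coact_ext
      (coact_lam u_sum u_col u_row coh_vac cohP coh_l coh_fst (stable Left) _ Tb c) _ => f _.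
    rewrite sum_ffcons; apply: eq_bigr => i _; rewrite mulr_sumr; apply: eq_bigr => I _.
    by rewrite u_chi_ffcons consE chi0 -scalerAr.
  have Tb i b v : r i (x i Right) (lact b v) = lact b (r i (x i Right) v).
    by have [-> //] := r_rep i; exact: Ci.
  apply: coact_ext
    (coact_rho u_sum u_col u_row coh_vac cohP coh_l coh_r coh_fst (stable Right) _ Tb c) _ => f _.
  rewrite sum_ffcons; apply: eq_bigr => i _; rewrite mulr_suml; apply: eq_bigr => I _.
  by rewrite u_chi_ffcons consE chi0 -scalerAl.
have gen k (s : 'I_n -> side) (I : 'I_n -> 'I_N) :
  gen_faces P (x (I k)) (s k) (x (I k) (s k)) by exact: gen_face_x.
(* Bi-freeness turns the moments on both sides into vacuum expectations, and [coactT] is evaluated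
   at the functional sending [z] to [psi z.1]. *)
rewrite (joint _ J chi _ (fun k => gen k chi J)).
rewrite -[LHS](coact_expect (coactT n chi J) psiP).
by apply: eq_bigr => I _; rewrite (joint _ I chi _ (fun k => gen k chi I)).
Qed.

Theorem proposition3p7 (R : realType) (A B : algType R[i]) (P : BBncps A B)
    (N : nat) (x : 'I_N -> side -> A)
    (x_pair : forall j, is_Bpair P (x j))
    (x_bifree : bifree P x)
    (x_id : identically_distributed P x)
    (phi : {scalar A})
    (phi_state : phi 1 = 1)
    (phi_E : forall a : A, phi (eps P (expect P a) 1) = phi a /\
                           phi a = phi (eps P 1 (expect P a)))
    (Q : cstarAlgType R) (u : 'I_N -> 'I_N -> Q)
    (Qu : is_CSNplus u) :
  quantum_bi_exchangeable phi x u.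
Proof.
move=> n chi J; have [mu _] := Qu; have [_ _ u_sum _] := mu.
(* The functional on [B] sends [b] to [phi (L_b)]; composed with [expect P] it gives back [phi]. *)
have psiP k b b' : phi (eps P (k *: b + b') 1) = k * phi (eps P b 1) + phi (eps P b' 1).
  by rewrite epsPl linearP.
have phiE a : phi a = phi (eps P (expect P a) 1) by case: (phi_E a).
rewrite phiE (quantum_invariance x_pair x_bifree x_id u_sum
  (magic_column mu) (magic_row mu) psiP).
by apply: eq_bigr => I _; rewrite -phiE.
Qed.
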